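(* Part I. Let $g_1\in L_{fin}SL(2,\mathbb C)$. Consider the following conditions. (I.1) $g_1$ is of the form $$g_1(z)=\begin{pmatrix} a_1(z)&b_1(z)\\ c_1^*(z)&d_1^*(z)\end{pmatrix},\quad z\in S^1,$$ where $a_1,b_1,c_1,d_1$ are polynomials in $z$ and $a_1(0)=d_1^*(\infty)\neq 0$. (I.2) $g_1$ has a factorization $$g_1(z)=\mathbf a(\eta_n)\begin{pmatrix}1&\eta_n^+z^n\\ \eta_n^-z^{-n}&1\end{pmatrix}\cdots \mathbf a(\eta_0)\begin{pmatrix}1&\eta_0^+\\ \eta_0^-&1\end{pmatrix}$$ for some finite collection $\eta_0,\dots,\eta_n$ of elements of $\{\eta=(\eta^-,\eta^+)\in\mathbb C^2: 1-\eta^-\eta^+\neq 0\}$ and some choice of the square roots $\mathbf a(\eta_k)$. (I.3) There is a nonzero constant $\mathbf a_1\in\mathbb C$ such that $g_1$ and $g_1^{-*}$ have triangular factorizations $$g_1=\begin{pmatrix}1&0\\ \sum_{j=0}^{n}\bar y_jz^{-j}&1\end{pmatrix}\begin{pmatrix}\mathbf a_1&0\\0&\mathbf a_1^{-1}\end{pmatrix}\begin{pmatrix}\alpha_1(z)&\beta_1(z)\\ \gamma_1(z)&\delta_1(z)\end{pmatrix},$$ $$g_1^{-*}=\begin{pmatrix}1&0\\ \sum_{j=0}^{n}\bar y'_jz^{-j}&1\end{pmatrix}\begin{pmatrix}\overline{\mathbf a_1}&0\\0&\overline{\mathbf a_1}^{-1}\end{pmatrix}\begin{pmatrix}\alpha'_1(z)&\beta'_1(z)\\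 \gamma'_1(z)&\delta'_1(z)\end{pmatrix}$$ (for some $n$ and complex $y_j,y_j'$), where in each case the third factor is an $SL(2,\mathbb C)$-valued polynomial in $z$ which is unipotent upper triangular at $z=0$. Then (I.1) and (I.3) are equivalent, and (I.2) implies (I.1) and (I.3). The converse, that (I.1) implies (I.2), holds generically, in the sense that the variables $\eta_k^{\pm}$ are rational functions of the Laurent coefficients of $b_1/a_1$ (at $z=0$) and $c_1^*/d_1^*$ (at $z=\infty$): they are determined recursively and rationally from these coefficients, provided $1-\eta_k^-\eta_k^+\neq0$ at each step. Part II. Let $g_2\in L_{fin}SL(2,\mathbb C)$. Consider the following conditions. (II.1) $g_2$ is of the form $$g_2(z)=\begin{pmatrix} a_2^*(z)&b_2^*(z)\\ c_2(z)&d_2(z)\end{pmatrix},\quad z\in S^1,$$ where $a_2,b_2,c_2,d_2$ are polynomials in $z$, $c_2(0)=b_2(0)=0$, and $a_2^*(\infty)=d_2(0)\neq0$. (II.2) $g_2$ has a factorization $$g_2(z)=\mathbf a(\zeta_n)\begin{pmatrix}1&\zeta_n^-z^{-n}\\ \zeta_n^+z^{n}&1\end{pmatrix}\cdots\mathbf a(\zeta_1)\begin{pmatrix}1&\zeta_1^-z^{-1}\\ \zeta_1^+z&1\end{pmatrix}$$ for some finite collection $\zeta_1,\dots,\zeta_n$ of elements of $\{\zeta=(\zeta^-,\zeta^+)\in\mathbb C^2:1-\zeta^-\zeta^+\neq0\}$ and some choice of the square roots $\mathbf a(\zeta_k)$. (II.3) There is a nonzero constant $\mathbf a_2\in\mathbb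 C$ such that $g_2$ and $g_2^{-*}$ have triangular factorizations $$g_2=\begin{pmatrix}1&\sum_{j=1}^{n}\bar x_jz^{-j}\\0&1\end{pmatrix}\begin{pmatrix}\mathbf a_2&0\\0&\mathbf a_2^{-1}\end{pmatrix}\begin{pmatrix}\alpha_2(z)&\beta_2(z)\\ \gamma_2(z)&\delta_2(z)\end{pmatrix},$$ $$g_2^{-*}=\begin{pmatrix}1&\sum_{j=1}^{n}\bar x'_jz^{-j}\\0&1\end{pmatrix}\begin{pmatrix}\overline{\mathbf a_2}&0\\0&\overline{\mathbf a_2}^{-1}\end{pmatrix}\begin{pmatrix}\alpha'_2(z)&\beta'_2(z)\\ \gamma'_2(z)&\delta'_2(z)\end{pmatrix}$$ (for some $n$ and complex $x_j,x_j'$), where in each case the third factor is an $SL(2,\mathbb C)$-valued polynomial in $z$ which is unipotent upper triangular at $z=0$. Then (II.1) and (II.3) are equivalent, and (II.2) implies (II.1) and (II.3). The converse, that (II.1) implies (II.2), holds generically, in the sense that the variables $\zeta_k^{\pm}$ are rational functions of the Laurent coefficients of $c_2/d_2$ (at $z=0$) and $b_2^*/a_2^*$ (at $z=\infty$): they are determined recursively and rationally from these coefficients, provided $1-\zeta_k^-\zeta_k^+\neq0$ at each step.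
   Context: $L_{fin}SL(2,\mathbb C)$ is the group of functions $S^1\to SL(2,\mathbb C)$ with finite Fourier series, under pointwise multiplication. For $f(z)=\sum f_nz^n$ put $f^*(z)=\sum\bar f_nz^{-n}$; so if $f$ is a polynomial in $z$ then $f^*$ is a polynomial in $z^{-1}$ and $f^*(\infty)=\overline{f(0)}$. For a matrix-valued loop $g$, $g^*$ is the pointwise Hermitian adjoint on $S^1$ and $g^{-*}:=(g^{-1})^*$. For $\zeta=(\zeta^-,\zeta^+)\in\mathbb C^2$ with $\zeta^-\zeta^+\ne1$, $\mathbf a(\zeta):=(1-\zeta^-\zeta^+)^{-1/2}$ denotes a choice of square root. Recursive solution: for $g_2$ as in (II.2), the coefficient of $z^k$ in $c_2/d_2$ (resp. of $z^{-k}$ in $b_2^*/a_2^*$) has the form $\zeta_k^{+}\prod_{1\le s<k}(1-\zeta_s^-\zeta_s^+)$ (resp. $\zeta_k^{-}\prod_{1\le s<k}(1-\zeta_s^-\zeta_s^+)$) plus a universal polynomial in $\zeta_s^\pm$, $s<k$; for $g_2$ as in (II.1) these equations are solved successively for $\zeta_1^\pm,\zeta_2^\pm,\dots$. The same applies to $g_1$, with the coefficient of $z^k$ in $b_1/a_1$ (resp. of $z^{-k}$ in $c_1^*/d_1^*$) equal to $\eta_k^{+}$ (resp. $\eta_k^-$) times $\prod_{0\le s<k}(1-\eta_s^-\eta_s^+)$ plus a universal polynomial in $\eta_s^\pm$, $s<k$. *)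

(* Defs.v *)
(* The complex numbers are R[i] for R : realType. *)
From HB Require Import structures.
From mathcomp Require Import all_boot all_order all_algebra.
From mathcomp Require Import reals complex mpoly.

Set Implicit Arguments.
Unset Strict Implicit.
Unset Printing Implicit Defensive.

Import Order.TTheory GRing.Theory Num.Theory.
Local Open Scope ring_scope.

Section Loops.
Variable R : realType.
Local Notation C := R[i].

Definition circle := {z : C | `|z| == 1}.
Definition circle_val (z : circle) : C := val z.
Coercion circle_val : circle >-> complex.

Definition loop := circle -> 'M[C]_2.

Definition finite_fourier (f : circle -> C) : Prop :=
  exists (N : nat) (c : int -> C), forall z : circle,
    f z = \sum_(k < N.*2.+1) c (k%:Z - N%:Z) * (z : C) ^ (k%:Z - N%:Z).

Definition LfinSL2 (g : loop) : Prop :=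
  (forall z, \det (g z) = 1) /\
  (forall i j, finite_fourier (fun z => g z i j)).

Definition mx22 (T : Type) (a b c d : T) : 'M[T]_2 :=
  \matrix_(i < 2, j < 2)
    if i == ord0 then (if j == ord0 then a else b)
    else (if j == ord0 then c else d).

(* For a polynomial f, [star f z] is the value at z of
   f^* = \sum_n conj(f_n) z^-n, and [star_infty f] is f^*(oo). *)
Definition star (f : {poly C}) (z : C) : C := (map_poly Num.conj f).[z^-1].
Definition star_infty (f : {poly C}) : C := Num.conj f.[0].

(* g^{-*}, with the Hermitian adjoint taken pointwise on the circle. *)
Definition inv_star (g : loop) : loop :=
  fun z => map_mx Num.conj (invmx (g z))^T.

Definition form1 (g : loop) (a b c d : {poly C}) : Prop :=
  [/\ forall z : circle, g z = mx22 a.[z] b.[z] (star c z) (star d z),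
      a.[0] = star_infty d & a.[0] != 0].

Definition form2 (g : loop) (a b c d : {poly C}) : Prop :=
  [/\ forall z : circle, g z = mx22 (star a z) (star b z) c.[z] d.[z],
      c.[0] = 0, b.[0] = 0, star_infty a = d.[0] & d.[0] != 0].

Definition condI1 (g : loop) : Prop := exists a b c d, form1 g a b c d.
Definition condII1 (g : loop) : Prop := exists a b c d, form2 g a b c d.

(* A pair (x, y) : C * C stands for zeta = (zeta^-, zeta^+): the first
   component is always the "minus" one. *)
Definition disc (zeta : C * C) : C := 1 - zeta.1 * zeta.2.

(* s k is the chosen square root a(eta_k); as the product is not commutative,
   the enumeration in decreasing order puts the index n leftmost. *)
Definition fact1 (n : nat) (eta : nat -> C * C) (g : loop) : Prop :=
  (forall k, (k <= n)%N -> disc (eta k) != 0) /\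
  exists s : nat -> C,
    (forall k, (k <= n)%N -> s k ^+ 2 = (disc (eta k))^-1) /\
    forall z : circle, g z =
      \prod_(k <- rev (index_iota 0 n.+1))
        (s k *: mx22 1 ((eta k).2 * (z : C) ^+ k)
                     ((eta k).1 * (z : C) ^- k) 1).

Definition fact2 (n : nat) (zeta : nat -> C * C) (g : loop) : Prop :=
  (forall k, (1 <= k <= n)%N -> disc (zeta k) != 0) /\
  exists s : nat -> C,
    (forall k, (1 <= k <= n)%N -> s k ^+ 2 = (disc (zeta k))^-1) /\
    forall z : circle, g z =
      \prod_(k <- rev (index_iota 1 n.+1))
        (s k *: mx22 1 ((zeta k).1 * (z : C) ^- k)
                     ((zeta k).2 * (z : C) ^+ k) 1).

Definition condI2 (g : loop) : Prop := exists n eta, fact1 n eta g.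
Definition condII2 (g : loop) : Prop := exists n zeta, fact2 n zeta g.

Definition eval_mx (H : 'M[{poly C}]_2) (z : C) : 'M[C]_2 :=
  map_mx (fun p : {poly C} => p.[z]) H.

Definition unipotent_at0 (H : 'M[{poly C}]_2) : Prop :=
  (forall z : C, \det (eval_mx H z) = 1) /\
  exists t : C, eval_mx H 0 = mx22 1 t 0 1.

Definition triangular1 (g : loop) (n : nat) (y : nat -> C) (a : C) : Prop :=
  exists H : 'M[{poly C}]_2, unipotent_at0 H /\
    forall z : circle, g z =
      mx22 1 0 (\sum_(0 <= j < n.+1) Num.conj (y j) * (z : C) ^- j) 1
      *m mx22 a 0 0 a^-1 *m eval_mx H z.

Definition triangular2 (g : loop) (n : nat) (x : nat -> C) (a : C) : Prop :=
  exists H : 'M[{poly C}]_2, unipotent_at0 H /\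
    forall z : circle, g z =
      mx22 1 (\sum_(1 <= j < n.+1) Num.conj (x j) * (z : C) ^- j) 0 1
      *m mx22 a 0 0 a^-1 *m eval_mx H z.

Definition condI3 (g : loop) : Prop :=
  exists a1 : C, a1 != 0 /\ exists (n : nat) (y y' : nat -> C),
    triangular1 g n y a1 /\ triangular1 (inv_star g) n y' (Num.conj a1).

Definition condII3 (g : loop) : Prop :=
  exists a2 : C, a2 != 0 /\ exists (n : nat) (x x' : nat -> C),
    triangular2 g n x a2 /\ triangular2 (inv_star g) n x' (Num.conj a2).

(* p / q = \sum_k (u k) z^k at z = 0; when q.[0] != 0 this determines u. *)
Definition expansion (p q : {poly C}) (u : nat -> C) : Prop :=
  forall k, p`_k = \sum_(i < k.+1) u i * q`_(k - i).

(* w k = (coefficient of z^-k in r^*/t^* at oo, coefficient of z^k in p/q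
   at 0). *)
Definition laurent_data (p q r t : {poly C}) (w : nat -> C * C) : Prop :=
  expansion p q (fun k => (w k).2) /\
  expansion (map_poly Num.conj r) (map_poly Num.conj t) (fun k => (w k).1).

(* In what follows m is the index of the first parameter (0 for eta, 1 for
   zeta), and a polynomial in the variables zeta_s^-, zeta_s^+ (m <= s < k) is
   an element of {mpoly C[nvars m k]}, the minus variables coming first. *)
Definition nvars (m k : nat) : nat := (k - m) + (k - m).

Definition coords (m k : nat) (w : nat -> C * C) : 'I_(nvars m k) -> C :=
  fun i => match split i with
           | inl j => (w (m + j)%N).1
           | inr j => (w (m + j)%N).2
           end.

Definition poly_family (m : nat) := forall k, {mpoly C[nvars m k]}.

(* The right-hand side of the k-th pair of equations
   w_k^{-,+} = zeta_k^{-,+} \prod_(m <= s < k) (1 - zeta_s^- zeta_s^+)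
               + (universal polynomial in zeta_s^{-,+}, m <= s < k). *)
Definition recursion_rhs m (Pm Pp : poly_family m) (zeta : nat -> C * C) k :
    C * C :=
  let D := \prod_(m <= s < k) disc (zeta s) in
  ((zeta k).1 * D + (Pm k).@[coords zeta], (zeta k).2 * D + (Pp k).@[coords zeta]).

(* The k-th pair of equations solved for zeta_k, given zeta_s for s < k. *)
Definition recursion_step m (Pm Pp : poly_family m) (w zeta : nat -> C * C) k :
    C * C :=
  let D := \prod_(m <= s < k) disc (zeta s) in
  (((w k).1 - (Pm k).@[coords zeta]) / D, ((w k).2 - (Pp k).@[coords zeta]) / D).

Fixpoint recursion_prefix m (Pm Pp : poly_family m) (w : nat -> C * C) k :
    seq (C * C) :=
  if k is k'.+1 then
    let l := recursion_prefix Pm Pp w k' in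
    rcons l (recursion_step Pm Pp w (nth 0 l) k')
  else [::].

(* The successive solution (zeta_k)_(k >= m); it is meaningful at k only when
   disc (zeta_s) != 0 for m <= s < k, and its values for k < m are junk that
   nothing depends on. *)
Definition recursive_solution m (Pm Pp : poly_family m) (w : nat -> C * C) k :
    C * C :=
  recursion_step Pm Pp w (nth 0 (recursion_prefix Pm Pp w k)) k.

(* zeta_k^{-,+} = N^{-,+} / D is a rational function of w_s^{-,+}
   (m <= s <= k), regular as soon as disc (zeta_s) != 0 for m <= s < k, and
   the rational function 1 - zeta_k^- zeta_k^+ is not identically zero. *)
Definition rational_solution m (Pm Pp : poly_family m) (k : nat) : Prop :=
  exists Nm Np D : {mpoly C[nvars m k.+1]},
    [/\ D != 0, D ^+ 2 - Nm * Np != 0 &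
        forall w : nat -> C * C,
          (forall s, (m <= s < k)%N ->
             disc (recursive_solution Pm Pp w s) != 0) ->
          D.@[coords w] != 0 /\
          recursive_solution Pm Pp w k =
            (Nm.@[coords w] / D.@[coords w], Np.@[coords w] / D.@[coords w])].

Definition sizes_le (n : nat) (a b c d : {poly C}) : Prop :=
  [/\ (size a <= n)%N, (size b <= n)%N, (size c <= n)%N & (size d <= n)%N].

End Loops.

(* Main.v *)
(** Up to the scalar s = prod a(eta_k), the product in (I.2) has entries
   A(z), B(z), C(1/z), D(1/z) with A(0) = D(0) = 1, and the n-th factor
   gives B_(n+1) A_n - A_(n+1) B_n = eta_n^+ z^n prod_(s < n) (1 - eta_s^- eta_s^+).
   Hence the n-th coefficient of B/A, which no longer changes afterwards, is eta_n^+ prod_(s < n) (1 - eta_s^- eta_s^+)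
   plus a polynomial in the earlier parameters; C/D follows by exchanging
   eta^+ and eta^-.  Conversely, if the recursion can be solved up to the degree n
   of g, the resulting product g' has the same expansions as g up to order n, and
   comparing orders and degrees in g' g^-1 shows that g' = g or g' = - g; the sign
   is absorbed in one of the square roots.  Part II is the same statement for the
   conjugate of g by [[0, 1], [1, 0]], with products starting at the index 1.
   For (I.3), the lower triangular factor Y is found by dividing c_1^* by a_1, which
   is invertible as a power series at 0; det g = 1 then makes d_1^* - Y b_1
   polynomial as well. *)

Require Import Defs.
From HB Require Import structures.
From mathcomp Require Import all_boot all_order all_algebra.
From mathcomp Require Import reals complex mpoly ring zify.

Set Implicit Arguments.
Unset Strict Implicit.
Unset Printing Implicit Defensive.

Import Order.TTheory GRing.Theory Num.Theory.
Local Open Scope ring_scope.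

(** * Quotients of power series *)

Section SeriesQuotient.
Variable S : comNzRingType.
Implicit Types p q : {poly S}.

(* Inverse of [q] modulo ['X^(k.+1)] when [q`_0 = 1]. *)
Definition inv_upto q k : {poly S} := \sum_(j < k.+1) (1 - q) ^+ j.

(** No division occurs, so this makes sense over a ring of multivariate polynomials and commutes
    with ring morphisms; over a field, when [q] has constant term 1, it is the coefficient of X^k in
    the series p / q. *)
Definition quot_coef p q k : S := (p * inv_upto q k)`_k.

Lemma mul_inv_upto q k : q * inv_upto q k = 1 - (1 - q) ^+ k.+1.
Proof. by rewrite -[RHS]opprB subrX1 -mulNr; congr (_ * _); ring. Qed.

End SeriesQuotient.

Lemma map_quot_coef (S S' : comNzRingType) (f : {rmorphism S -> S'})
    (p q : {poly S}) k :
  quot_coef (map_poly f p) (map_poly f q) k = f (quot_coef p q k).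
Proof.
rewrite /quot_coef -coef_map rmorphM /= rmorph_sum /=.
congr (polyseq _)`_k; congr (_ * _); apply: eq_bigr => j _.
by rewrite rmorphXn rmorphB rmorph1.
Qed.

Section SeriesQuotientField.
Variable F : fieldType.
Implicit Types p q : {poly F}.

Lemma dvdXnP n p : reflect (forall i, (i < n)%N -> p`_i = 0) ('X^n %| p).
Proof.
apply: (iffP idP) => [/dvdpP[q ->] i lt_in | p0]; first by rewrite coefMXn lt_in.
apply/dvdpP; exists (\poly_(i < size p) p`_(n + i)).
apply/polyP=> i; rewrite coefMXn; case: ltnP => [/p0//|le_ni].
rewrite coef_poly subnKC //; case: ltnP => // le_si.
by rewrite nth_default // (leq_trans le_si) ?leq_subr.
Qed.

Lemma dvdXn_mul_inv_upto q k : q`_0 = 1 -> 'X^(k.+1) %| q * inv_upto q k - 1.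
Proof.
move=> q0; rewrite mul_inv_upto addrAC subrr add0r dvdpNr dvdp_exp2r //.
rewrite -['X]expr1; apply/dvdXnP => -[|//] _.
by rewrite coefB q0 coef1 subrr.
Qed.

(** Multiplying p = W q by the inverse of q modulo X^(k+1) recovers W, so a coefficient of p / q can
    be read off any convenient approximation W. *)
Lemma quot_coef_uniq p q (W : {poly F}) k :
  q`_0 = 1 -> 'X^(k.+1) %| p - W * q -> quot_coef p q k = W`_k.
Proof.
move=> q0 dvd_pWq; apply/eqP; rewrite -subr_eq0 -coefB; apply/eqP.
apply: (dvdXnP k.+1 _ _ _ (ltnSn k)).
have -> : p * inv_upto q k - W =
  (p - W * q) * inv_upto q k + W * (q * inv_upto q k - 1) by ring.
by apply: dvdp_add; [apply: dvdp_mulr | apply/dvdp_mull/dvdXn_mul_inv_upto].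
Qed.

Lemma quot_coef_mul_inv_upto p q n k : q`_0 = 1 -> (k <= n)%N ->
  (p * inv_upto q n)`_k = quot_coef p q k.
Proof.
move=> q0 le_kn; apply/esym/quot_coef_uniq => //.
have -> : p - p * inv_upto q n * q = - p * (q * inv_upto q n - 1) by ring.
apply: dvdp_mull; apply: dvdp_trans (dvdXn_mul_inv_upto n q0).
by rewrite dvdp_exp2l.
Qed.

(** As series, p'/q' - p/q = e X^n / (q q'), and q q' has constant term 1; up to degree n only the
    term e X^n remains. *)
Lemma quot_coef_step p q p' q' e n k : q`_0 = 1 -> q'`_0 = 1 ->
  p' * q - q' * p = e%:P * 'X^n -> (k <= n)%N ->
  quot_coef p' q' k = quot_coef p q k + (if k == n then e else 0).
Proof.
move=> q0 q'0 E le_kn; set W := p * inv_upto q k + e%:P * 'X^n.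
have -> : quot_coef p q k + (if k == n then e else 0) = W`_k.
  rewrite coefD coefCM coefXn quot_coef_mul_inv_upto //.
  by case: eqP; rewrite ?mulr1 ?mulr0.
apply: quot_coef_uniq => //.
(* The factor q brings in the cross product known from [E]; being prime to X, it is cancelled at the
   end. *)
have: 'X^(k.+1) %| q * (p' - W * q').
  have -> : q * (p' - W * q') =
      p' * q - q' * p - e%:P * 'X^n * (q * q') - q' * p * (q * inv_upto q k - 1).
    by rewrite /W; ring.
  rewrite E -[X in X - _ - _]mulr1 -mulrBr.
  apply: dvdp_sub; last by rewrite dvdp_mull // dvdXn_mul_inv_upto.
  rewrite -mulrA dvdp_mull // exprSr dvdp_mul ?dvdp_exp2l //.
  rewrite -['X]expr1; apply/dvdXnP => -[|//] _.
  by rewrite coefB coef1 coef0M q0 q'0 mulr1 subrr.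
rewrite Gauss_dvdpr // coprimep_expl // coprimep_sym coprimepX.
by rewrite rootE horner_coef0 q0 oner_eq0.
Qed.

End SeriesQuotientField.

(** * Expansions at 0 and cross products of fractions *)

Section Expansion.
Variable F : fieldType.
Implicit Types (p q a b A B : {poly F}) (u : nat -> F).

Lemma expansion_dvdXn p q u n :
  (forall k, p`_k = \sum_(i < k.+1) u i * q`_(k - i)) ->
  'X^n %| p - \poly_(i < n) u i * q.
Proof.
move=> E; apply/dvdXnP => k lt_kn; rewrite coefB coefM E -sumrB big1 // => i _.
by rewrite coef_poly (leq_ltn_trans _ lt_kn) ?subrr // -ltnS.
Qed.

Lemma expansion_quot_coef s p q u k : s != 0 -> q`_0 = 1 ->
  (forall k, (s *: p)`_k = \sum_(i < k.+1) u i * (s *: q)`_(k - i)) ->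
  u k = quot_coef p q k.
Proof.
move=> s0 q0 /(expansion_dvdXn k.+1); rewrite -scalerAr -scalerBr dvdpZr //.
by move/(quot_coef_uniq q0) ->; rewrite coef_poly ltnSn.
Qed.

(** Formally b A - a B = a A (b/a - B/A), and the two series agree below degree n. *)
Lemma expansion_cross_dvdXn a b A B u n : A`_0 = 1 ->
  (forall k, b`_k = \sum_(i < k.+1) u i * a`_(k - i)) ->
  (forall k, (k < n)%N -> u k = quot_coef B A k) ->
  'X^n %| b * A - a * B.
Proof.
move=> A0 /(expansion_dvdXn n) dvd_b uE; case: n => [|n] in dvd_b uE *.
  by rewrite dvd1p.
set U := \poly_(i < _) u i in dvd_b.
have -> : b * A - a * B = (b - U * a) * A + a * A * (U - B * inv_upto A n)
    + a * B * (A * inv_upto A n - 1) by ring.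
apply: dvdp_add; last by apply/dvdp_mull/dvdXn_mul_inv_upto.
apply: dvdp_add; first exact: dvdp_mulr.
apply/dvdp_mull/dvdXnP => k lt_kn.
by rewrite coefB coef_poly lt_kn uE // quot_coef_mul_inv_upto // subrr.
Qed.

End Expansion.

Lemma size_polyM_leS (S : nzRingType) n k (p q : {poly S}) :
  (size p <= n.+1)%N -> (size q <= k.+1)%N -> (size (p * q)%R <= (n + k).+1)%N.
Proof.
move=> sp sq; apply: leq_trans (size_polyMleq _ _) _.
by rewrite -subn1 leq_subLR add1n -addSn -addnS leq_add.
Qed.

(** * Rigidity of loops with the same expansions *)

Section Rigidity.
Variable F : fieldType.
Implicit Types p q : {poly F}.

Lemma dvdXn_mulr n p q : q`_0 != 0 -> 'X^n %| p * q -> 'X^n %| p.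
Proof.
move=> q0; rewrite Gauss_dvdpl // coprimep_expl // coprimep_sym coprimepX.
by rewrite rootE horner_coef0.
Qed.

(* With C = z^n c^*, D = z^n d^* the matrices [[a, b], [c^*, d^*]] and
   [[a', b'], [c'^*, d'^*]] have determinant 1; the entries of their quotient are,
   up to powers of z, the polynomials P, T, q, r below. *)
Lemma form_rigidity n (a b C D a' b' C' D' : {poly F}) :
  (size b <= n.+1)%N -> (size D <= n.+1)%N ->
  (size b' <= n.+1)%N -> (size D' <= n.+1)%N ->
  a * D - b * C = 'X^n -> a' * D' - b' * C' = 'X^n ->
  a`_0 = D`_n -> a`_0 != 0 -> a'`_0 = D'`_n -> a'`_0 != 0 ->
  'X^(n.+1) %| b * a' - a * b' -> (size (C * D' - D * C' : {poly F})%R <= n)%N ->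
  exists2 l, l ^+ 2 = 1 &
    [/\ a' = l *: a, b' = l *: b, C' = l *: C & D' = l *: D].
Proof.
move=> sb sD sb' sD' det det' aD a0 aD' a'0 dvd_q sr.
pose P := a' * D - b' * C; pose T := a * D' - b * C'.
pose q := a * b' - b * a'; pose r := C' * D - D' * C.
have {}dvd_q : 'X^(n.+1) %| q by rewrite -dvdpNr opprB.
have {}sr : (size r <= n)%N.
  have -> : r = - (C * D' - D * C') by rewrite /r; ring.
  by rewrite size_polyN.
have dvd_qn : 'X^n %| q by apply: dvdp_trans dvd_q; rewrite dvdp_exp2l.
(* With g and g' the two matrices, these are entries of (g' g^-1) g = g' and of (g' g^-1)^-1 g' = g,
   cleared of denominators. *)
have Pa : P * a + q * C = a' * 'X^n by rewrite -det /P /q; ring.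
have Pb : P * b + q * D = b' * 'X^n by rewrite -det /P /q; ring.
have Ta : T * a' - q * C' = a * 'X^n by rewrite -det' /T /q; ring.
have PD : P * D' = D * 'X^n + r * b' by rewrite -det' /P /r; ring.
have TD : T * D = D' * 'X^n - r * b by rewrite -det /T /r; ring.
have TC : T * C = C' * 'X^n - r * a by rewrite -det /T /r; ring.
have dvd_P : 'X^n %| P.
  apply: (dvdXn_mulr a0); rewrite -[P * a](addrK (q * C)) Pa.
  by rewrite dvdp_sub ?dvdp_mulIr ?dvdp_mulr.
have dvd_T : 'X^n %| T.
  apply: (dvdXn_mulr a'0); rewrite -[T * a'](subrK (q * C')) Ta.
  by rewrite dvdp_add ?dvdp_mulIr ?dvdp_mulr.
have [t TE] := dvdpP _ _ dvd_T; have [p PE] := dvdpP _ _ dvd_P.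
(* As r has degree below n, the right-hand side has degree at most 2n and r h does not reach X^(2n).
   Since U has degree exactly n, u is constant, and the coefficients of X^(2n) give the equality. *)
have sz_const (u U V h : {poly F}) : (size U <= n.+1)%N -> U`_n != 0 ->
    (size V <= n.+1)%N -> (size h <= n.+1)%N ->
    u * 'X^n * U = V * 'X^n + r * h -> u = (u`_0)%:P /\ u`_0 * U`_n = V`_n.
  move=> sU U0 sV sh uE.
  have rh0 : (r * h)`_(n + n) = 0.
    rewrite nth_default // (leq_trans (size_polyMleq _ _)) //; lia.
  have su : (size (u * U)%R <= n.+1)%N.
    have: (size (u * U * 'X^n)%R <= n.+1 + n)%N.
      rewrite mulrAC uE (leq_trans (size_polyD _ _)) // geq_max.
      apply/andP; split; apply: leq_trans (size_polyMleq _ _) _.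
        by rewrite size_polyXn; lia.
      by lia.
    have [-> | uU0] := eqVneq (u * U) 0; first by rewrite size_poly0.
    by rewrite size_mulXn // addnC leq_add2r.
  have sU' : size U = n.+1.
    by apply/eqP; rewrite eqn_leq sU ltnNge; apply: contra U0 => /leq_sizeP->.
  have {}su : u = (u`_0)%:P.
    apply: size1_polyC; have [-> | u0] := eqVneq u 0; first by rewrite size_poly0.
    have Un0 : U != 0 by rewrite -size_poly_eq0 sU'.
    by move: su; rewrite size_mul // sU' addnS /= -add1n leq_add2r.
  split=> //; have /(congr1 (fun p : {poly F} => p`_(n + n))) := uE.
  rewrite mulrAC !coefD rh0 addr0 !coefMXn ltnNge leq_addr /= addnK.
  by rewrite {1}su coefCM.
have Dn0 : D`_n != 0 by rewrite -aD.
have D'n0 : D'`_n != 0 by rewrite -aD'.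
have [tE tDn] : t = (t`_0)%:P /\ t`_0 * D`_n = D'`_n.
  by apply: (sz_const _ _ _ (- b)); rewrite ?size_polyN // -TE TD mulrN.
have [pE _] : p = (p`_0)%:P /\ p`_0 * D'`_n = D`_n.
  by apply: (sz_const _ _ _ b') => //; rewrite -PE PD.
(* The comparison at the low end: X^(n+1) divides q, so q h does not reach the coefficient of
   X^n. *)
have coef_n (u v h k : {poly F}) : u * 'X^n * v + q * h = k * 'X^n ->
    u`_0 * v`_0 = k`_0.
  move/(congr1 (fun x : {poly F} => x`_n)); rewrite mulrAC coefD !coefMXn ltnn subnn.
  by rewrite coef0M (dvdXnP _ _ (dvdp_mulr h dvd_q)) ?addr0.
have ta' : t`_0 * a'`_0 = a`_0 by apply: (coef_n _ _ (- C')); rewrite -TE mulrN.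
have pa : p`_0 * a`_0 = a'`_0 by apply: (coef_n _ _ C); rewrite -PE.
set l := t`_0 in tE tDn ta'.
(* The high ends give l a(0) = a'(0), through a(0) = D_n and a'(0) = D'_n, while the low ends give l
   a'(0) = a(0); hence l^2 = 1. *)
have la : l * a`_0 = a'`_0 by rewrite aD aD'.
have pl : p`_0 = l by apply: (mulIf a0); rewrite pa.
have l2 : l ^+ 2 = 1 by apply: (mulIf a'0); rewrite expr2 -mulrA ta' la mul1r.
have Xn0 : 'X^n != 0 :> {poly F} by rewrite -size_poly_eq0 size_polyXn.
have {}TE : T = l *: 'X^n by rewrite TE tE mul_polyC.
have {}PE : P = l *: 'X^n by rewrite PE pE pl mul_polyC.
(* r a is a multiple of X^n and a(0) is nonzero, so X^n divides r, whose degree is below n. *)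
have r0 : r = 0.
  apply/polyP=> i; rewrite coef0; case: (ltnP i n) => [|le_ni]; last first.
    by rewrite nth_default // (leq_trans sr).
  apply: dvdXnP; apply: (dvdXn_mulr a0).
  have -> : r * a = C' * 'X^n - T * C by rewrite TC opprB addrC subrK.
  by rewrite TE dvdp_sub ?dvdp_mulIr // -scalerAl scalerAr dvdp_mulIl.
(* X^(n+1) divides q, but q D = X^n (b' - l b) has degree at most 2n and D has degree n. *)
have q0 : q = 0.
  apply/eqP/negPn/negP => q_neq0.
  have Dn : size D = n.+1.
    by apply/eqP; rewrite eqn_leq sD ltnNge; apply: contra Dn0 => /leq_sizeP->.
  have D0 : D != 0 by rewrite -size_poly_eq0 Dn.
  have sq : (n.+2 <= size q)%N.
    by have := dvdp_leq q_neq0 dvd_q; rewrite size_polyXn.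
  have : (size (q * D)%R <= n.+1 + n)%N.
    rewrite -[q * D](addKr (P * b)) Pb PE -scalerAl scalerAr mulrC addrC -mulrBl.
    rewrite (leq_trans (size_polyMleq _ _)) // size_polyXn addnS /= leq_add2r.
    rewrite (leq_trans (size_polyD _ _)) // geq_max sb' size_polyN.
    exact: leq_trans (size_scale_leq _ _) sb.
  by rewrite size_mul // Dn addnS /= leqNgt ltn_add2r sq.
exists l => //; split; apply: (mulIf Xn0).
- by rewrite -Pa PE q0 mul0r addr0 -!scalerAl mulrC.
- by rewrite -Pb PE q0 mul0r addr0 -!scalerAl mulrC.
- by rewrite -[C' * _](subrK (r * a)) -TC r0 mul0r addr0 TE -!scalerAl mulrC.
by rewrite -[D' * _](subrK (r * b)) -TD r0 mul0r addr0 TE -!scalerAl mulrC.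
Qed.

End Rigidity.

(** * Splitting off the triangular factor, for polynomials *)

Section TriangularPolynomials.
Variable F : fieldType.
Implicit Types (a b C D V : {poly F}).

(** V truncates the series C / a; the determinant relation gives a (D - V b) = X^N + b (C - V a), so
    the same V reduces D modulo X^N. With e = 0, V has one more coefficient, which makes u vanish at
    0; with e = 1 it is left out, so that the sum over z^-j can start at j = 1. *)
Lemma triangular_polys e N a b C D : (e <= 1)%N -> a`_0 != 0 ->
  a * D - b * C = 'X^N ->
  exists V u v, [/\ (size V <= N.+1 - e)%N, C = V * a + u * 'X^N,
    D = V * b + v * 'X^N, a * v - b * u = 1 & e = 0%N -> u`_0 = 0].
Proof.
(* Rescaling a to constant term 1 makes the truncated inverse available; W is then C / a modulo
   X^(N+1). *)
move=> e1 a0 det; pose k := ((a`_0)^-1)%:P; pose a1 := k * a.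
have a10 : a1`_0 = 1 by rewrite coefCM mulVf.
pose W := k * C * inv_upto a1 N; pose V := take_poly (N.+1 - e) W.
have dvd_C : 'X^(N.+1 - e) %| C - V * a.
  have -> : C - V * a = (W - V) * a - C * (a1 * inv_upto a1 N - 1).
    by rewrite /W {2}/a1; ring.
  apply: dvdp_sub; last first.
    apply/dvdp_mull/(dvdp_trans _ (dvdXn_mul_inv_upto N a10)).
    by rewrite dvdp_exp2l // leq_subr.
  apply/dvdp_mulr/dvdXnP => i lt_i.
  by rewrite coefB coef_take_poly lt_i subrr.
have dvdN : 'X^N %| C - V * a.
  by apply: dvdp_trans dvd_C; rewrite dvdp_exp2l //; lia.
have dvdD : 'X^N %| D - V * b.
  apply: (dvdXn_mulr a0).
  have -> : (D - V * b) * a = 'X^N + b * (C - V * a) by rewrite -det; ring.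
  by rewrite dvdp_add ?dvdpp ?dvdp_mull.
have [u uE] := dvdpP _ _ dvdN; have [v vE] := dvdpP _ _ dvdD.
exists V, u, v; split.
- exact: size_take_poly.
- by rewrite -uE addrC subrK.
- by rewrite -vE addrC subrK.
- have Xn0 : 'X^N != 0 :> {poly F} by rewrite -size_poly_eq0 size_polyXn.
  apply: (mulIf Xn0); rewrite mulrBl -!mulrA -uE -vE mul1r -det; ring.
move=> e0; move: dvd_C; rewrite e0 subn0 => /dvdXnP/(_ N (ltnSn N)).
by rewrite uE coefMXn ltnn subnn.
Qed.

End TriangularPolynomials.

(** * Polynomials generated by products of elementary factors *)

Section Layers.
Variable S : comNzRingType.
Implicit Types (p q : {poly S}) (eta : nat -> S * S).

(* [rev_poly n p] is the polynomial X^n p(1/X) when [size p <= n.+1]. *)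
Definition rev_poly n p : {poly S} := \poly_(i < n.+1) p`_(n - i).

Lemma rev_polyD n p q : rev_poly n (p + q) = rev_poly n p + rev_poly n q.
Proof.
by apply/polyP=> i; rewrite coefD !coef_poly coefD; case: ifP; rewrite ?addr0.
Qed.

Lemma rev_polyZ n c p : rev_poly n (c *: p) = c *: rev_poly n p.
Proof.
by apply/polyP=> i; rewrite coefZ !coef_poly coefZ; case: ifP; rewrite ?mulr0.
Qed.

Lemma size_rev_poly n p : (size (rev_poly n p) <= n.+1)%N.
Proof. exact: size_poly. Qed.

Lemma rev_polyS n p : (size p <= n.+1)%N -> rev_poly n.+1 p = 'X * rev_poly n p.
Proof.
move=> sp; apply/polyP=> -[|i]; rewrite coefXM !coef_poly /=.
  by rewrite subn0 nth_default.
by rewrite ltnS subSS.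
Qed.

Lemma rev_polyK n p : (size p <= n.+1)%N -> rev_poly n (rev_poly n p) = p.
Proof.
move=> sp; apply/polyP=> i; rewrite !coef_poly !ltnS leq_subr.
by case: leqP => [le_in | lt_ni]; rewrite ?subKn // nth_default ?(leq_trans sp).
Qed.

(** Exchanging eta^- and eta^+ exchanges the rows and the columns of the product, together with z
    and 1/z. The lower row therefore needs no definition of its own: its entries are [numer] and
    [denom] for [swap \o eta]. *)
Definition swap (x : S * S) : S * S := (x.2, x.1).

(* The product, for k < n, of the matrices [[1, eta_k^+ z^k], [eta_k^- z^-k, 1]]
   is applied to a column (x(z), y(1/z)). *)
Fixpoint layers eta (v : {poly S} * {poly S}) n : {poly S} * {poly S} :=
  if n is k.+1 then
    let u := layers eta v k in
    (u.1 + (eta k).2 *: rev_poly k u.2, u.2 + (eta k).1 *: rev_poly k u.1)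
  else v.

Definition numer eta n : {poly S} := (layers eta (0, 1) n).1.
Definition denom eta n : {poly S} := (layers eta (1, 0) n).1.

Lemma layers_swap eta v n :
  layers (swap \o eta) (v.2, v.1) n = ((layers eta v n).2, (layers eta v n).1).
Proof. by elim: n => //= n ->. Qed.

Lemma eq_layers eta eta' v n : (forall s, (s < n)%N -> eta s = eta' s) ->
  layers eta v n = layers eta' v n.
Proof.
elim: n => //= n IHn E; rewrite E // IHn // => s lt_sn.
by apply: E; rewrite ltnW.
Qed.

Lemma numer_swapK eta n : numer (swap \o (swap \o eta)) n = numer eta n.
Proof. by rewrite /numer (@eq_layers _ eta) // => s _ /=; case: (eta s). Qed.

Lemma denom_swapK eta n : denom (swap \o (swap \o eta)) n = denom eta n.
Proof. by rewrite /denom (@eq_layers _ eta) // => s _ /=; case: (eta s). Qed.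

Lemma numerS eta n :
  numer eta n.+1 =
    numer eta n + (eta n).2 *: rev_poly n (denom (swap \o eta) n).
Proof. by rewrite /numer /denom (layers_swap eta (0, 1)). Qed.

Lemma denomS eta n :
  denom eta n.+1 =
    denom eta n + (eta n).2 *: rev_poly n (numer (swap \o eta) n).
Proof. by rewrite /numer /denom (layers_swap eta (1, 0)). Qed.

Lemma size_numer_denom eta n :
  (size (numer eta n) <= n)%N && (size (denom eta n) <= maxn 1 n)%N.
Proof.
elim: n => [|n /andP[sN sD]]; first by rewrite size_poly0 size_poly1.
have szZ c p : (size (c *: rev_poly n p) <= n.+1)%N.
  exact: leq_trans (size_scale_leq _ _) (size_rev_poly _ _).
rewrite numerS denomS; apply/andP; split; apply: leq_trans (size_polyD _ _) _;
  rewrite geq_max; first by rewrite leqW //=.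
by rewrite (maxn_idPr _) // szZ (leq_trans sD) // geq_max leqnSn.
Qed.

Lemma size_numer eta n : (size (numer eta n) <= n)%N.
Proof. by case/andP: (size_numer_denom eta n). Qed.

Lemma size_denom eta n : (size (denom eta n) <= n.+1)%N.
Proof.
have /andP[_ sD] := size_numer_denom eta n.
by apply: leq_trans sD _; rewrite geq_max leqnSn.
Qed.

Lemma size_denomS eta n : (size (denom eta n.+1) <= n.+1)%N.
Proof. by have /andP[_] := size_numer_denom eta n.+1; rewrite (maxn_idPr _). Qed.

(** [numer] has degree below n, so its reversal, which the next factor adds to [denom], vanishes at
    0. *)
Lemma denom_coef0 eta n : (denom eta n)`_0 = 1.
Proof.
elim: n => [|n IHn]; first by rewrite coef1.
by rewrite denomS coefD coefZ IHn coef_poly subn0 nth_default ?size_numer // mulr0 addr0.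
Qed.

(** The determinant of the product is the product of the determinants of its factors; the lower row
    is multiplied by X^n to become polynomial. *)
Lemma layers_det eta n :
  rev_poly n (denom (swap \o eta) n) * denom eta n
    - rev_poly n (numer (swap \o eta) n) * numer eta n
  = (\prod_(0 <= s < n) (1 - (eta s).1 * (eta s).2))%:P * 'X^n.
Proof.
elim: n => [|n IHn].
  rewrite big_geq // mulr0 subr0 !mulr1; apply/polyP=> i.
  by rewrite coef_poly !coef1; case: i.
have sN := leqW (size_numer (swap \o eta) n).
rewrite big_nat_recr //= polyCM exprS.
have -> (x : S) (y z : {poly S}) : x%:P * y * ('X * z) = y * 'X * (x%:P * z) by ring.
rewrite -IHn (denomS eta) (numerS eta) (denomS (swap \o eta)) (numerS (swap \o eta)).
rewrite numer_swapK denom_swapK /=.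
rewrite !rev_polyD !rev_polyZ !(@rev_polyS n) ?size_rev_poly ?size_denom //.
rewrite !rev_polyK ?size_denom // ?leqW ?size_numer //.
rewrite -!mul_polyC polyCB polyCM; ring.
Qed.

(** The k-th coefficient of B/A before the k-th factor is applied. It involves only the parameters
    of index s < k and will be the universal polynomial of the recursion. *)
Definition remainder eta k : S := quot_coef (numer eta k) (denom eta k) k.

Lemma eq_remainder eta eta' k : (forall s, (s < k)%N -> eta s = eta' s) ->
  remainder eta k = remainder eta' k.
Proof. by rewrite /remainder /numer /denom => E; rewrite !(eq_layers _ E). Qed.

End Layers.

(** * Universality of the remainder *)

Section MapLayers.
Variables (S S' : comNzRingType) (f : {rmorphism S -> S'}).
Implicit Types eta : nat -> S * S.

Let fpair (x : S * S) : S' * S' := (f x.1, f x.2).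

Lemma map_rev_poly n (p : {poly S}) :
  map_poly f (rev_poly n p) = rev_poly n (map_poly f p).
Proof.
apply/polyP=> i; rewrite coef_map [in LHS]coef_poly coef_poly coef_map.
by case: ifP; rewrite ?raddf0.
Qed.

Lemma map_layers eta v n :
  layers (fpair \o eta) (map_poly f v.1, map_poly f v.2) n =
    (map_poly f (layers eta v n).1, map_poly f (layers eta v n).2).
Proof.
elim: n => //= n ->; congr (_, _); rewrite rmorphD /= linearZ /= map_rev_poly //.
Qed.

(** Computed once with indeterminate parameters, the remainder is a polynomial whose values are the
    remainders for numerical parameters. *)
Lemma map_remainder eta k : f (remainder eta k) = remainder (fpair \o eta) k.
Proof.
have := map_layers eta (0, 1) k; have := map_layers eta (1, 0) k.
rewrite /= !rmorph0 !rmorph1 /remainder /numer /denom => -> ->.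
by rewrite map_quot_coef.
Qed.

End MapLayers.

(** * Effect of one more factor on the expansion *)

Section RemainderField.
Variable F : fieldType.
Implicit Types eta : nat -> F * F.

(** The cross product of two consecutive fractions is eta_n^+ times the determinant of [layers_det],
    a constant multiple of X^n. *)
Lemma quot_coef_layersS eta n k : (k <= n)%N ->
  quot_coef (numer eta n.+1) (denom eta n.+1) k =
    quot_coef (numer eta n) (denom eta n) k +
    (if k == n then
       (eta n).2 * \prod_(0 <= s < n) (1 - (eta s).1 * (eta s).2) else 0).
Proof.
apply: quot_coef_step; rewrite ?denom_coef0 //.
rewrite polyCM -mulrA -layers_det numerS denomS -!mul_polyC; ring.
Qed.

Lemma quot_coef_layers eta n k : (k < n)%N ->
  quot_coef (numer eta n) (denom eta n) k =
    (eta k).2 * \prod_(0 <= s < k) (1 - (eta s).1 * (eta s).2) + remainder eta k.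
Proof.
elim: n => // n IHn; rewrite ltnS => le_kn; rewrite quot_coef_layersS //.
case: eqVneq => [->|ne_kn]; first by rewrite addrC.
by rewrite addr0 IHn // ltn_neqAle ne_kn.
Qed.

End RemainderField.

(** * Two-by-two matrices *)

Section Matrix22.
Variable S : comNzRingType.
Implicit Types a b c d : S.

Lemma mx22_inj a b c d a' b' c' d' : mx22 a b c d = mx22 a' b' c' d' ->
  [/\ a = a', b = b', c = c' & d = d'].
Proof.
by move/matrixP=> E; split;
  [move: (E 0 0) | move: (E 0 1) | move: (E 1 0) | move: (E 1 1)]; rewrite !mxE.
Qed.

Lemma mx22_eta (M : 'M[S]_2) : M = mx22 (M 0 0) (M 0 1) (M 1 0) (M 1 1).
Proof.
by apply/matrixP=> i j; rewrite mxE; case: i => [[|[|//]] ?]; case: j => [[|[|//]] ?];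
  rewrite //=; congr (M _ _); apply: val_inj.
Qed.

Lemma eq_mx22 (M N : 'M[S]_2) : M 0 0 = N 0 0 -> M 0 1 = N 0 1 ->
  M 1 0 = N 1 0 -> M 1 1 = N 1 1 -> M = N.
Proof. by rewrite [M]mx22_eta [N]mx22_eta !mxE /= => -> -> -> ->. Qed.

Lemma mul_mx22 a b c d a' b' c' d' :
  mx22 a b c d *m mx22 a' b' c' d' =
  mx22 (a * a' + b * c') (a * b' + b * d') (c * a' + d * c') (c * b' + d * d').
Proof. by apply: eq_mx22; rewrite !mxE !big_ord_recl big_ord0 !mxE /= addr0. Qed.

Lemma scale_mx22 e a b c d : e *: mx22 a b c d = mx22 (e * a) (e * b) (e * c) (e * d).
Proof. by apply: eq_mx22; rewrite !mxE. Qed.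

Lemma map_mx22 (S' : comNzRingType) (f : S -> S') a b c d :
  map_mx f (mx22 a b c d) = mx22 (f a) (f b) (f c) (f d).
Proof. by apply/matrixP=> i j; rewrite !mxE; do 2![case: ifP]. Qed.

Lemma det_mx22 a b c d : \det (mx22 a b c d) = a * d - b * c.
Proof.
rewrite (expand_det_row _ 0) !big_ord_recl big_ord0 addr0 /cofactor !det_mx11 !mxE /=.
by rewrite /bump /= !mul1r expr1 mulN1r mulrN.
Qed.

(* Conjugation by the permutation matrix [[0, 1], [1, 0]]; it exchanges the
   shapes of the factors in the two parts of the theorem. *)
Definition flip (M : 'M[S]_2) : 'M[S]_2 := mx22 (M 1 1) (M 1 0) (M 0 1) (M 0 0).

Lemma flip_mx22 a b c d : flip (mx22 a b c d) = mx22 d c b a.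
Proof. by rewrite /flip !mxE. Qed.

Lemma flipK : involutive flip.
Proof. by move=> M; rewrite /flip !mxE /= -mx22_eta. Qed.

Lemma flip_mul (M N : 'M[S]_2) : flip (M *m N) = flip M *m flip N.
Proof.
rewrite [M]mx22_eta [N]mx22_eta mul_mx22 !flip_mx22 mul_mx22.
by congr mx22; rewrite addrC.
Qed.

Lemma flip_prod I (r : seq I) (F : I -> 'M[S]_2) :
  flip (\prod_(i <- r) F i) = \prod_(i <- r) flip (F i).
Proof.
elim: r => [|i r IHr]; last by rewrite !big_cons [LHS]flip_mul IHr.
by rewrite !big_nil; apply: eq_mx22; rewrite !mxE.
Qed.

Lemma flip_scale e (M : 'M[S]_2) : flip (e *: M) = e *: flip M.
Proof. by apply: eq_mx22; rewrite !mxE. Qed.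

Lemma det_flip (M : 'M[S]_2) : \det (flip M) = \det M.
Proof. by rewrite [M]mx22_eta flip_mx22 !det_mx22; ring. Qed.

End Matrix22.

Lemma invmx22 (F : fieldType) (a b c d : F) : \det (mx22 a b c d) = 1 ->
  invmx (mx22 a b c d) = mx22 d (- b) (- c) a.
Proof.
move=> det1; have U : mx22 a b c d \in unitmx by rewrite unitmxE det1 unitr1.
rewrite -[RHS]mul1mx -(mulVmx U) -mulmxA mul_mx22 -[LHS]mulmx1; congr (_ *m _).
move: det1; rewrite det_mx22 => det1.
by apply: eq_mx22; rewrite !mxE /= -?det1; ring.
Qed.

Lemma horner_rev_poly (F : fieldType) n (p : {poly F}) z : z != 0 ->
  (size p <= n.+1)%N -> (rev_poly n p).[z] = z ^+ n * p.[z^-1].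
Proof.
move=> z0 sp; rewrite (horner_coef_wide _ (size_rev_poly n p)) (horner_coef_wide _ sp).
rewrite (reindex_inj rev_ord_inj) mulr_sumr /=; apply: eq_bigr => i _.
have le_in : (i <= n)%N by rewrite -ltnS.
rewrite coef_poly subSS ltnS leq_subr subKn // mulrCA exprVn; congr (_ * _).
by rewrite -[X in _ ^+ X / _](subnK le_in) exprD mulfK // expf_neq0.
Qed.

(** * Points of the unit circle *)

Section Circle.
Variable R : realType.
Local Notation C := R[i].
Implicit Types (z : circle R) (p q : {poly C}).

Lemma circle_neq0 z : (z : C) != 0.
Proof. by rewrite -normr_eq0 (eqP (valP z)) oner_eq0. Qed.

Lemma circle_conj z : Num.conj (z : C) = (z : C)^-1.
Proof. by rewrite invC_norm (eqP (valP z)) expr1n invr1 mul1r. Qed.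

Fact circle_inv_subproof z : `|(z : C)^-1| == 1.
Proof. by rewrite normfV (eqP (valP z)) invr1. Qed.

Definition circle_inv z : circle R := Sub (z : C)^-1 (circle_inv_subproof z).

Lemma natr_subi_neq0 n : n%:R - 'i != 0 :> C.
Proof.
apply/eqP=> /(congr1 ( *%R^~ (n%:R + 'i))); rewrite -subr_sqr sqrCi opprK mul0r.
by apply/eqP; rewrite -natrX natr1 pnatr_eq0.
Qed.

Fact circle_point_subproof n : `|(n%:R + 'i) / (n%:R - 'i) : C| == 1.
Proof.
have E : n%:R + 'i = Num.conj (n%:R - 'i) :> C.
  by rewrite rmorphB /= conjCi rmorph_nat opprK.
by rewrite normf_div E norm_conjC divff // normr_eq0 natr_subi_neq0.
Qed.

(** The Cayley transform of the natural numbers: infinitely many points of the circle, enough to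
    determine a polynomial by its values there. *)
Definition circle_point n : circle R :=
  Sub ((n%:R + 'i) / (n%:R - 'i) : C) (circle_point_subproof n).

Lemma circle_point_inj : injective circle_point.
Proof.
move=> n k /(congr1 val) /= /eqP; rewrite eqr_div ?natr_subi_neq0 // => /eqP E.
apply/eqP; rewrite -(eqr_nat C) -subr_eq0.
have : 2 * 'i * (k%:R - n%:R) == 0 :> C.
  have -> : 2 * 'i * (k%:R - n%:R) =
    (n%:R + 'i) * (k%:R - 'i) - (k%:R + 'i) * (n%:R - 'i) :> C by ring.
  by rewrite E subrr.
by rewrite !mulf_eq0 pnatr_eq0 (negPf (neq0Ci _)) /= !subr_eq0 eq_sym.
Qed.

Lemma circle_polyP p q : (forall z, p.[z] = q.[z]) -> p = q.
Proof.
move=> E; apply/eqP; rewrite -subr_eq0; apply/eqP.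
apply: (@roots_geq_poly_eq0 _ _ [seq val (circle_point i) | i <- iota 0 (size (p - q))]).
- by apply/allP=> _ /mapP[i _ ->]; rewrite rootE !hornerE (E (circle_point i)) subrr.
- by rewrite map_inj_uniq ?iota_uniq // => i j /val_inj/circle_point_inj.
by rewrite size_map size_iota.
Qed.

Lemma conj_horner p (x : C) : Num.conj p.[x] = (map_poly Num.conj p).[Num.conj x].
Proof. by rewrite horner_map. Qed.

Lemma map_poly_conjK : involutive (map_poly (@Num.conj C) : {poly C} -> {poly C}).
Proof. by move=> p; rewrite -map_poly_comp map_poly_id // => x _; exact: conjCK. Qed.

End Circle.

Lemma rev_index_iotaS m n : (m <= n)%N ->
  rev (index_iota m n.+1) = n :: rev (index_iota m n).
Proof.
by move=> le_mn; rewrite /index_iota subSn // -addn1 iotaD rev_cat subnKC.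
Qed.

(** * Evaluation of the products *)

Section EvalLayers.
Variable F : fieldType.
Implicit Types (eta : nat -> F * F) (x : F).

Lemma horner_numerS eta n x : x != 0 ->
  (numer eta n.+1).[x] =
    (numer eta n).[x] + (eta n).2 * (x ^+ n * (denom (@swap _ \o eta) n).[x^-1]).
Proof.
by move=> x0; rewrite numerS hornerD hornerZ horner_rev_poly ?size_denom.
Qed.

Lemma horner_denomS eta n x : x != 0 ->
  (denom eta n.+1).[x] =
    (denom eta n).[x] + (eta n).2 * (x ^+ n * (numer (@swap _ \o eta) n).[x^-1]).
Proof.
by move=> x0; rewrite denomS hornerD hornerZ horner_rev_poly ?(leqW (size_numer _ _)).
Qed.

Definition layer_mx eta n x : 'M[F]_2 :=
  mx22 (denom eta n).[x] (numer eta n).[x]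
    (numer (@swap _ \o eta) n).[x^-1] (denom (@swap _ \o eta) n).[x^-1].

Lemma scale_denom_coef0 s eta n : (s *: denom eta n)`_0 = s.
Proof. by rewrite coefZ denom_coef0 mulr1. Qed.

(* The case [eta 0 = 0] is that of the products starting with the index 1. *)
Lemma scale_numer_coef0 s eta n : eta 0%N = 0 -> (s *: numer eta n)`_0 = 0.
Proof.
move=> eta0; rewrite coefZ; suff -> : (numer eta n)`_0 = 0 by rewrite mulr0.
elim: n => [|n IHn]; first by rewrite coef0.
rewrite numerS coefD coefZ IHn coef_poly subn0 add0r.
case: n {IHn} => [|n]; first by rewrite eta0 mul0r.
by rewrite nth_default ?mulr0 ?size_denomS.
Qed.

Lemma scale_horner_mx22 l (a b c d : {poly F}) x y :
  mx22 (l *: a).[x] (l *: b).[x] (l *: c).[y] (l *: d).[y] =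
  l *: mx22 a.[x] b.[x] c.[y] d.[y].
Proof. by rewrite scale_mx22 !hornerZ. Qed.

Lemma scale_layer_mx s eta n x : s *: layer_mx eta n x =
  mx22 (s *: denom eta n).[x] (s *: numer eta n).[x]
    (s *: numer (@swap _ \o eta) n).[x^-1] (s *: denom (@swap _ \o eta) n).[x^-1].
Proof. exact/esym/scale_horner_mx22. Qed.

Lemma layer_mx0 eta x : layer_mx eta 0 x = 1.
Proof.
rewrite /layer_mx /numer /denom [layers _ _ _]/= !horner0 !hornerC.
by apply: eq_mx22; rewrite !mxE.
Qed.

Lemma layer_mxS eta n x : x != 0 ->
  layer_mx eta n.+1 x =
    mx22 1 ((eta n).2 * x ^+ n) ((eta n).1 * x ^- n) 1 *m layer_mx eta n x.
Proof.
move=> x0; have xV0 : x^-1 != 0 by rewrite invr_eq0.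
rewrite /layer_mx mul_mx22 !horner_numerS // !horner_denomS // invrK exprVn.
by rewrite numer_swapK denom_swapK /= !mul1r !mulrA; congr mx22; rewrite addrC.
Qed.

(** A factor with parameter 0 is the identity, so a product starting at m is one starting at 0 with
    parameters padded by zeros; the scalars are collected in front. *)
Lemma prod_layers m n (eta eta' : nat -> F * F) (s : nat -> F) x : x != 0 ->
  (forall k, (k < m)%N -> eta' k = 0) -> (forall k, (m <= k)%N -> eta' k = eta k) ->
  \prod_(k <- rev (index_iota m n))
    (s k *: mx22 1 ((eta k).2 * x ^+ k) ((eta k).1 * x ^- k) 1) =
  (\prod_(m <= k < n) s k) *: layer_mx eta' n x.
Proof.
move=> x0 eta'0 eta'E; elim: n => [|n IHn].
  by rewrite /index_iota sub0n /= !big_nil scale1r layer_mx0.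
rewrite layer_mxS //; have [lt_nm | le_mn] := ltnP n m.
  move: IHn; rewrite /index_iota; have -> : (n.+1 - m = 0)%N by lia.
  have -> : (n - m = 0)%N by lia.
  move=> /= ->; rewrite big_nil eta'0 // !mul0r; congr (_ *: _).
  by rewrite -[LHS]mul1mx; congr (_ *m _); apply: eq_mx22; rewrite !mxE.
have scaleMM (a b : F) (A B : 'M_2) : (a *: A) *m (b *: B) = (b * a) *: (A *m B).
  by rewrite -scalemxAl -scalemxAr scalerA mulrC.
rewrite rev_index_iotaS // big_cons IHn big_nat_recr //= eta'E //; exact: scaleMM.
Qed.

End EvalLayers.

(** * The recursion and its universal polynomials *)

Section Recursion.
Variables (R : realType) (m : nat).
Local Notation C := R[i].
Implicit Types w zeta : nat -> C * C.

Lemma eq_coords k zeta zeta' :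
  (forall s, (m <= s < k)%N -> zeta s = zeta' s) ->
  coords (m := m) (k := k) zeta =1 coords zeta'.
Proof.
by move=> E i; rewrite /coords; case: split => j; rewrite E //; have := ltn_ord j; lia.
Qed.

Section Solution.
Variables Pm Pp : poly_family R m.

Lemma eq_recursion_step w zeta zeta' k :
  (forall s, (m <= s < k)%N -> zeta s = zeta' s) ->
  recursion_step Pm Pp w zeta k = recursion_step Pm Pp w zeta' k.
Proof.
move=> E; rewrite /recursion_step; congr ((_ - _) / _, (_ - _) / _).
- exact/meval_eq/eq_coords.
- by apply: eq_big_nat => s /E->.
- exact/meval_eq/eq_coords.
- by apply: eq_big_nat => s /E->.
Qed.

Lemma nth_recursion_prefix w k s : (s < k)%N ->
  nth 0 (recursion_prefix Pm Pp w k) s = recursive_solution Pm Pp w s.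
Proof.
have sz n : size (recursion_prefix Pm Pp w n) = n.
  by elim: n => //= n IHn; rewrite size_rcons IHn.
elim: k => // k IHk; rewrite ltnS leq_eqVlt /= nth_rcons sz.
by case/predU1P=> [->|lt_sk]; rewrite ?ltnn ?eqxx // lt_sk IHk.
Qed.

(** The list of earlier values can be replaced by the solution itself, since a step reads only the
    indices s with m <= s < k. *)
Lemma recursive_solutionE w k :
  recursive_solution Pm Pp w k =
    recursion_step Pm Pp w (recursive_solution Pm Pp w) k.
Proof. by apply: eq_recursion_step => s /andP[_]; exact: nth_recursion_prefix. Qed.

Lemma recursion_stepP w zeta k : (forall s, (m <= s < k)%N -> disc (zeta s) != 0) ->
  w k = recursion_rhs Pm Pp zeta k <-> zeta k = recursion_step Pm Pp w zeta k.
Proof.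
move=> nz; have D0 : \prod_(m <= s < k) disc (zeta s) != 0.
  by rewrite big_nat; elim/big_ind: _ => // [|x y]; [exact: oner_neq0 | exact: mulf_neq0].
rewrite /recursion_rhs /recursion_step; split=> E.
  by rewrite E /= !addrK !mulfK //; case: (zeta k).
by rewrite [zeta k]E /= !divfK // !subrK; case: (w k).
Qed.

Lemma recursive_solution_unique w zeta n :
  (forall k, (m <= k <= n)%N -> disc (zeta k) != 0) ->
  (forall k, (m <= k <= n)%N -> w k = recursion_rhs Pm Pp zeta k) ->
  forall k, (m <= k <= n)%N -> zeta k = recursive_solution Pm Pp w k.
Proof.
move=> nz rec; elim/ltn_ind => k IHk le_mkn.
rewrite recursive_solutionE -(@eq_recursion_step w zeta); last first.
  by move=> s lt_msk; apply: IHk; lia.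
by apply/recursion_stepP; [move=> s ?; apply: nz; lia | exact: rec].
Qed.

End Solution.

(* The parameters of index less than m, which do not occur in the product,
   are replaced by 0: the corresponding factors become trivial. *)
Definition from_index zeta k : C * C := if (k < m)%N then 0 else zeta k.

(** Indeterminates in the places of the parameters, padded by 0 below m; the final 0, for s >= k, is
    a default that [remainder] of order k never reads. *)
Definition param_vars k s : {mpoly C[nvars m k]} * {mpoly C[nvars m k]} :=
  if (s < m)%N then 0 else
  if insub (s - m)%N is Some j then ('X_(lshift _ j), 'X_(rshift _ j)) else 0.

Definition minus_poly : poly_family R m :=
  fun k => remainder (@swap _ \o param_vars k) k.

Definition plus_poly : poly_family R m := fun k => remainder (param_vars k) k.

Lemma meval_param_vars k zeta s : (s < k)%N ->
  ((param_vars k s).1.@[coords zeta], (param_vars k s).2.@[coords zeta]) =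
    from_index zeta s.
Proof.
move=> lt_sk; rewrite /param_vars /from_index.
case: ltnP => [|le_ms]; first by rewrite !meval0.
case: insubP => [j _ j_eq | ]; last by lia.
rewrite !mevalXU /coords (unsplitK (inl j)) (unsplitK (inr j)) j_eq subnKC //.
by case: (zeta s).
Qed.

Lemma meval_minus_poly k zeta :
  (minus_poly k).@[coords zeta] = remainder (@swap _ \o from_index zeta) k.
Proof.
rewrite /minus_poly (map_remainder (meval (coords zeta))).
apply: eq_remainder => s lt_sk /=; rewrite -(meval_param_vars _ lt_sk) //.
Qed.

Lemma meval_plus_poly k zeta :
  (plus_poly k).@[coords zeta] = remainder (from_index zeta) k.
Proof.
rewrite /plus_poly (map_remainder (meval (coords zeta))).
by apply: eq_remainder => s lt_sk /=; rewrite -(meval_param_vars _ lt_sk).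
Qed.

Lemma prod_disc_from_index zeta k : (m <= k)%N ->
  \prod_(m <= s < k) disc (zeta s) = \prod_(0 <= s < k) disc (from_index zeta s).
Proof.
move=> le_mk; rewrite [RHS](@big_cat_nat _ _ _ m) //= [X in _ = X * _]big_nat.
rewrite [X in _ = X * _]big1 => [|s /= lt_sm]; last first.
  by rewrite /from_index lt_sm /disc mulr0 subr0.
rewrite mul1r; apply: eq_big_nat => s /andP[le_ms _].
by rewrite /from_index ltnNge le_ms.
Qed.

Lemma recursion_rhsE zeta k : (m <= k)%N ->
  let e := from_index zeta in
  recursion_rhs minus_poly plus_poly zeta k =
    ((e k).1 * \prod_(0 <= s < k) disc (e s) + remainder (@swap _ \o e) k,
     (e k).2 * \prod_(0 <= s < k) disc (e s) + remainder e k).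
Proof.
move=> le_mk; rewrite /recursion_rhs meval_minus_poly meval_plus_poly.
by rewrite prod_disc_from_index //= /from_index ltnNge le_mk.
Qed.

End Recursion.

(** * Loops in polynomial form, and their recursion *)

Section Forms.
Variable R : realType.
Local Notation C := R[i].
Implicit Types (g : loop R) (z : circle R) (a b c d : {poly C}).
Implicit Types (eta : nat -> C * C) (w : nat -> C * C).

(** The polynomials c and d already have conjugated coefficients, so the lower row is evaluated at
    1/z without a star. Both parts reduce to this form, the second one after [flip]. *)
Definition has_form g a b c d : Prop :=
  forall z, g z = mx22 a.[z] b.[z] c.[(z : C)^-1] d.[(z : C)^-1].

Lemma circle_inv_polyP (p q : {poly C}) :
  (forall z, p.[(z : C)^-1] = q.[(z : C)^-1]) -> p = q.
Proof.
by move=> E; apply: circle_polyP => z; have := E (circle_inv z); rewrite /= invrK.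
Qed.

Lemma has_form_unique g a b c d a' b' c' d' :
  has_form g a b c d -> has_form g a' b' c' d' ->
  [/\ a = a', b = b', c = c' & d = d'].
Proof.
move=> F F'; have E z : mx22 a.[z] b.[z] c.[(z : C)^-1] d.[(z : C)^-1]
  = mx22 a'.[z] b'.[z] c'.[(z : C)^-1] d'.[(z : C)^-1] by rewrite -F -F'.
by split; [apply: circle_polyP | apply: circle_polyP | apply: circle_inv_polyP
  | apply: circle_inv_polyP] => z; case/mx22_inj: (E z).
Qed.

Lemma has_form_det g a b c d n :
  (forall z, \det (g z) = 1) -> has_form g a b c d ->
  (size c <= n.+1)%N -> (size d <= n.+1)%N ->
  a * rev_poly n d - b * rev_poly n c = 'X^n.
Proof.
move=> det1 F sc sd; apply: circle_polyP => z; rewrite !hornerE.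
rewrite !horner_rev_poly ?circle_neq0 // -[RHS]mulr1 -(det1 z) F det_mx22; ring.
Qed.

(* The factorizations (I.2), for m = 0, and (II.2) conjugated by [flip], for m = 1. *)
Definition factorized m n eta g : Prop :=
  (forall k, (m <= k <= n)%N -> disc (eta k) != 0) /\
  exists s : nat -> C,
    (forall k, (m <= k <= n)%N -> s k ^+ 2 = (disc (eta k))^-1) /\
    forall z, g z =
      \prod_(k <- rev (index_iota m n.+1))
        (s k *: mx22 1 ((eta k).2 * (z : C) ^+ k)
                     ((eta k).1 * (z : C) ^- k) 1).

Lemma factorized_has_form m n eta g : factorized m n eta g ->
  let e := from_index m eta in
  exists2 s, s != 0 &
    has_form g (s *: denom e n.+1) (s *: numer e n.+1)
      (s *: numer (@swap _ \o e) n.+1) (s *: denom (@swap _ \o e) n.+1).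
Proof.
move=> [nz [s [s2 gE]]] e; exists (\prod_(m <= k < n.+1) s k).
  rewrite big_nat; elim/big_ind: _ => [|x y|k lt_mkn]; first exact: oner_neq0.
    exact: mulf_neq0.
  have le_mkn : (m <= k <= n)%N by lia.
  by have := nz k le_mkn; rewrite -invr_eq0 -s2 // sqrf_eq0.
move=> z; rewrite gE (@prod_layers _ m _ _ e) ?circle_neq0 //.
- exact: scale_layer_mx.
- by move=> k lt_km; rewrite /e /from_index lt_km.
- by move=> k le_mk; rewrite /e /from_index ltnNge le_mk.
Qed.

(** The polynomials of a loop are unique, so a, b, c, d are s times those of the product; s cancels
    in the quotients, and [quot_coef_layers] gives their coefficients. *)
Lemma factorized_recursion m n eta g a b c d w :
  factorized m n eta g -> has_form g a b c d ->
  expansion b a (fun k => (w k).2) -> expansion c d (fun k => (w k).1) ->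
  forall k, (m <= k <= n)%N ->
    w k = recursion_rhs (@minus_poly R m) (@plus_poly R m) eta k.
Proof.
move=> fac F wp wm k /andP[le_mk le_kn].
have [s s0 F'] := factorized_has_form fac.
have [Ea Eb Ec Ed] := has_form_unique F F'.
rewrite Ea Eb in wp; rewrite Ec Ed in wm.
rewrite recursion_rhsE // [w k]surjective_pairing.
have -> := expansion_quot_coef k s0 (denom_coef0 _ _) wp.
have -> := expansion_quot_coef k s0 (denom_coef0 _ _) wm.
rewrite !quot_coef_layers //=; congr (_ * _ + _, _).
by apply: eq_bigr => i _; rewrite mulrC.
Qed.

End Forms.

(** * From the recursive solution to a factorization *)

Section Converse.
Variable R : realType.
Local Notation C := R[i].
Implicit Types (g : loop R) (z : circle R) (p q c d : {poly C}).
Implicit Types (eta w : nat -> C * C).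

Lemma rev_polyM n k p q : (size p <= n.+1)%N -> (size q <= k.+1)%N ->
  rev_poly (n + k) (p * q) = rev_poly n p * rev_poly k q.
Proof.
move=> sp sq; apply: circle_polyP => z; have z0 := circle_neq0 z.
rewrite hornerM !horner_rev_poly // ?hornerM ?exprD; first by rewrite mulrACA.
exact: size_polyM_leS.
Qed.

(** Reversal exchanges low and high coefficients: agreement of the expansions at infinity becomes
    the degree bound required by [form_rigidity]. *)
Lemma size_rev_cross n c d c' d' :
  (size c <= n.+1)%N -> (size d <= n.+1)%N ->
  (size c' <= n.+1)%N -> (size d' <= n.+1)%N ->
  'X^(n.+1) %| c * d' - d * c' ->
  (size (rev_poly n c * rev_poly n d' - rev_poly n d * rev_poly n c' : {poly C})%R
     <= n)%N.
Proof.
move=> sc sd sc' sd' /dvdXnP dvd; rewrite -!rev_polyM //.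
apply/leq_sizeP => i le_ni; rewrite coefB !coef_poly.
by case: ifP => _; rewrite ?subrr // -coefB dvd //; lia.
Qed.

Lemma remainder_eq0 eta k : (forall s, (s < k)%N -> eta s = 0) -> remainder eta k = 0.
Proof.
move=> /eq_remainder->; rewrite /remainder; suff -> : numer (fun=> 0) k = 0 :> {poly C}.
  by rewrite /quot_coef mul0r coef0.
by elim: k => // k IHk; rewrite numerS IHk scale0r addr0.
Qed.

Lemma factorized_det m n eta g z : factorized m n eta g -> \det (g z) = 1.
Proof.
case=> nz [s [s2 ->]]; rewrite big_seq.
elim/big_ind: _ => [|A B detA detB|k]; first exact: det1.
  by rewrite [LHS]det_mulmx detA detB mulr1.
rewrite mem_rev mem_index_iota ltnS => le_mkn.
rewrite scale_mx22 det_mx22 !mulr1 -(divff (nz k le_mkn)) -s2 // /disc.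
have zk : (z : C) ^+ k != 0 by rewrite expf_neq0 ?circle_neq0.
by field.
Qed.

(** The sign l is put into the square root of the leftmost factor, which exists because m <= n. *)
Lemma factorized_scale m n eta g l : (m <= n)%N -> l ^+ 2 = 1 ->
  factorized m n eta g -> factorized m n eta (fun z => l *: g z).
Proof.
move=> le_mn l2 [nz [s [s2 gE]]]; split=> //.
exists (fun k => if k == n then l * s k else s k); split=> [k le_mkn | z].
  by case: ifP => _; rewrite ?exprMn ?l2 ?mul1r s2.
rewrite gE rev_index_iotaS // !big_cons eqxx -scalerA [LHS]scalemxAl.
congr (_ *m _); apply: eq_big_seq => k.
by rewrite mem_rev mem_index_iota => /andP[_ /ltn_eqF->].
Qed.

Lemma factorized_recursive_solution m n g a b c d w : (m <= n)%N ->
  (forall z, \det (g z) = 1) -> has_form g a b c d -> a`_0 = d`_0 -> a`_0 != 0 ->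
  expansion b a (fun k => (w k).2) -> expansion c d (fun k => (w k).1) ->
  (forall k, (k < m)%N -> w k = 0) -> sizes_le n.+1 a b c d ->
  let eta := recursive_solution (@minus_poly R m) (@plus_poly R m) w in
  (forall k, (m <= k <= n)%N -> disc (eta k) != 0) ->
  factorized m n eta g.
Proof.
move=> le_mn det1 F ad a0 wp wm w0 [sa sb sc sd] eta nz.
pose s k : C := sqrtC (disc (eta k))^-1.
pose g' z := \prod_(k <- rev (index_iota m n.+1))
  (s k *: mx22 1 ((eta k).2 * (z : C) ^+ k) ((eta k).1 * (z : C) ^- k) 1).
have fac' : factorized m n eta g'.
  by split=> //; exists s; split=> // k _; rewrite sqrtCK.
clearbody g'.
have [t t0] := factorized_has_form fac'; set e := from_index m eta => F'.
(* Through order n the data w are the expansions of g'. For k < m both sides vanish: w by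
   hypothesis, the other because the padded parameters are 0. *)
have wE k : (k < n.+1)%N -> w k =
    (quot_coef (numer (@swap _ \o e) n.+1) (denom (@swap _ \o e) n.+1) k,
     quot_coef (numer e n.+1) (denom e n.+1) k).
  move=> lt_kn; rewrite !quot_coef_layers //=; have [lt_km | le_mk] := ltnP k m.
    have e0 s' : (s' <= k)%N -> e s' = 0.
      by move=> le_sk; rewrite /e /from_index (leq_ltn_trans le_sk lt_km).
    rewrite w0 // e0 // !mul0r !add0r !remainder_eq0 //=.
      by move=> s' lt_sk; rewrite e0 // ltnW.
    by move=> s' lt_sk; rewrite e0 // ltnW.
  have -> : w k = recursion_rhs (@minus_poly R m) (@plus_poly R m) eta k.
    apply/recursion_stepP; last exact: recursive_solutionE.
    by move=> s' lt_msk; apply: nz; lia.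
  rewrite recursion_rhsE //; congr (_ * _ + _, _).
  by apply: eq_bigr => i _; rewrite /disc mulrC.
(* [dvd1] controls the order at 0 of the upper right entry of g' g^-1, and [dvd2], after reversal,
   the degree of the lower left one. *)
have dvd1 : 'X^(n.+1) %| b * (t *: denom e n.+1) - a * (t *: numer e n.+1).
  rewrite -!scalerAr -scalerBr dvdpZr //; apply: expansion_cross_dvdXn wp _.
    exact: denom_coef0.
  by move=> k /wE->.
have dvd2 : 'X^(n.+1) %| c * (t *: denom (@swap _ \o e) n.+1)
    - d * (t *: numer (@swap _ \o e) n.+1).
  rewrite -!scalerAr -scalerBr dvdpZr //; apply: expansion_cross_dvdXn wm _.
    exact: denom_coef0.
  by move=> k /wE->.
have szD e' : (size (t *: denom e' n.+1) <= n.+1)%N.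
  exact: leq_trans (size_scale_leq _ _) (size_denomS _ _).
have szN e' : (size (t *: numer e' n.+1) <= n.+1)%N.
  exact: leq_trans (size_scale_leq _ _) (size_numer _ _).
have rev0 p : (rev_poly n p)`_n = p`_0 by rewrite coef_poly ltnSn subnn.
have den' e' : (t *: denom e' n.+1)`_0 = t := scale_denom_coef0 t e' _.
have t0' e' : (t *: denom e' n.+1)`_0 != 0 by rewrite den'.
have [l l2 [Ea Eb Ec Ed]] :=
  form_rigidity sb (size_rev_poly n d) (szN e) (size_rev_poly n _)
    (has_form_det det1 F sc sd)
    (has_form_det (fun z => factorized_det z fac') F' (szN _) (szD _))
    (etrans ad (esym (rev0 d))) a0 (etrans (den' _) (esym (etrans (rev0 _) (den' _))))
    (t0' e) dvd1 (size_rev_cross sc sd (szN _) (szD _) dvd2).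
have {}Ec : t *: numer (@swap _ \o e) n.+1 = l *: c.
  by rewrite -[LHS](@rev_polyK _ n) ?szN // Ec rev_polyZ rev_polyK.
have {}Ed : t *: denom (@swap _ \o e) n.+1 = l *: d.
  by rewrite -[LHS](@rev_polyK _ n) ?szD // Ed rev_polyZ rev_polyK.
(* Since g' = l g with l^2 = 1, scaling the factorization of g' by l gives one of g. *)
have [nz' [r [r2 gE]]] := factorized_scale le_mn l2 fac'.
split; [exact: nz' | exists r; split; first exact: r2] => z.
transitivity (l *: g' z).
  have -> : g' z = l *: g z.
    by rewrite [g z]F -scale_horner_mx22 -Ea -Eb -Ec -Ed; exact: F'.
  by rewrite scalerA -expr2 l2 scale1r.
exact: (gE z).
Qed.

End Converse.

(** * Rational functions of the Laurent data *)

Section Rational.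
Variables (R : realType) (m K : nat) (good : (nat -> R[i] * R[i]) -> Prop).
Local Notation C := R[i].
Implicit Types (w : nat -> C * C) (f h : (nat -> C * C) -> C).

(** Regularity on [good] is part of the notion, so inversion only asks that the values be nonzero
    there. *)
Definition rational f : Prop := exists N D : {mpoly C[nvars m K]},
  forall w, good w -> D.@[coords w] != 0 /\ f w = N.@[coords w] / D.@[coords w].

Lemma rational_poly (P : {mpoly C[nvars m K]}) : rational (fun w => P.@[coords w]).
Proof. by exists P, 1 => w _; rewrite meval1 oner_neq0 divr1. Qed.

Lemma eq_rational f h : (forall w, good w -> f w = h w) -> rational f -> rational h.
Proof. by move=> E [N [D ND]]; exists N, D => w gw; rewrite -E //; exact: ND. Qed.

Lemma rational_const c : rational (fun=> c).
Proof.
by apply: eq_rational (rational_poly c%:MP) => w _; rewrite mevalC.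
Qed.

Lemma rationalD f h : rational f -> rational h -> rational (fun w => f w + h w).
Proof.
move=> [N [D ND]] [N' [D' ND']]; exists (N * D' + N' * D), (D * D') => w gw.
have [D0 ->] := ND w gw; have [D'0 ->] := ND' w gw.
by rewrite mevalD !mevalM mulf_neq0 // addf_div.
Qed.

Lemma rationalM f h : rational f -> rational h -> rational (fun w => f w * h w).
Proof.
move=> [N [D ND]] [N' [D' ND']]; exists (N * N'), (D * D') => w gw.
have [D0 ->] := ND w gw; have [D'0 ->] := ND' w gw.
by rewrite !mevalM mulf_neq0 // mulf_div.
Qed.

Lemma rationalV f : (forall w, good w -> f w != 0) -> rational f ->
  rational (fun w => (f w)^-1).
Proof.
move=> nz [N [D ND]]; exists D, N => w gw; have [D0 fE] := ND w gw.
rewrite fE invf_div; split=> //; have := nz w gw.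
by rewrite fE mulf_eq0 negb_or => /andP[].
Qed.

Lemma rationalB f h : rational f -> rational h -> rational (fun w => f w - h w).
Proof.
move=> rf rh; apply: (rationalD rf); have := rationalM (rational_const (-1)) rh.
by apply: eq_rational => w _; rewrite mulN1r.
Qed.

Lemma rational_prod (I : eqType) (r : seq I) (f : I -> (nat -> C * C) -> C) :
  (forall i, i \in r -> rational (f i)) -> rational (fun w => \prod_(i <- r) f i w).
Proof.
elim: r => [|i r IHr] rf.
  by apply: eq_rational (rational_const 1) => w _; rewrite big_nil.
apply: (@eq_rational (fun w => f i w * \prod_(j <- r) f j w)).
  by move=> w _; rewrite big_cons.
apply: rationalM; first by apply: rf; rewrite mem_head.
by apply: IHr => j jr; apply: rf; rewrite in_cons jr orbT.
Qed.

Lemma rational_meval n (P : {mpoly C[n]}) (v : (nat -> C * C) -> 'I_n -> C) :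
  (forall i, rational (v^~ i)) -> rational (fun w => P.@[v w]).
Proof.
move=> rv; elim/mpolyind: P => [|c mon P _ _ IH].
  by apply: eq_rational (rational_const 0) => w _; rewrite meval0.
apply: (@eq_rational (fun w => c * 'X_[mon].@[v w] + P.@[v w])).
  by move=> w _; rewrite mevalD mevalZ.
apply: rationalD => //; apply: rationalM; first exact: rational_const.
apply: (@eq_rational (fun w =>
  \prod_(i <- index_enum 'I_n) \prod_(j <- iota 0 (mon i)) v w i)).
  move=> w _; rewrite mevalX; apply: eq_bigr => i _.
  by rewrite big_const_seq count_predT size_iota iter_mulr_1.
by apply: rational_prod => i _; apply: rational_prod.
Qed.

Lemma rational_coord s : (m <= s < K)%N ->
  rational (fun w => (w s).1) /\ rational (fun w => (w s).2).
Proof.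
move=> lt_msK; have lt_s : (s - m < K - m)%N by lia.
have sE : (m + (s - m))%N = s by lia.
split; [apply: eq_rational (rational_poly 'X_(lshift _ (Ordinal lt_s)))
      | apply: eq_rational (rational_poly 'X_(rshift _ (Ordinal lt_s)))] => w _.
  by rewrite mevalXU /coords (unsplitK (inl _)) /= sE.
by rewrite mevalXU /coords (unsplitK (inr _)) /= sE.
Qed.

End Rational.

(** * Rationality of the recursive solution *)

Section RationalSolution.
Variables (R : realType) (m : nat) (Pm Pp : poly_family R m).
Local Notation C := R[i].
Local Notation sol := (recursive_solution Pm Pp).

(** K and [good] stay fixed while the induction runs over j <= k, so all intermediate functions are
    quotients in one polynomial ring, on one domain. *)
Lemma rational_recursive_solution K k : (m <= k < K)%N ->
  let good w := forall s, (m <= s < k)%N -> disc (sol w s) != 0 in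
  rational m K good (fun w => (sol w k).1) /\ rational m K good (fun w => (sol w k).2).
Proof.
move=> lt_mkK good.
suff H j : (m <= j <= k)%N ->
    rational m K good (fun w => (sol w j).1) /\ rational m K good (fun w => (sol w j).2).
  by apply: H; lia.
elim/ltn_ind: j => j IHj le_mjk.
have rcoords (P : {mpoly C[nvars m j]}) :
    rational m K good (fun w => P.@[coords (sol w)]).
  apply: rational_meval => i; rewrite /coords; case: split => l;
    by have := ltn_ord l => lt_l; case: (IHj (m + l)%N); lia || by [].
have rdisc : rational m K good (fun w => (\prod_(m <= s < j) disc (sol w s))^-1).
  apply: rationalV.
    move=> w gw; rewrite big_nat.
    elim/big_ind: _ => [|x y|s lt_msj]; first exact: oner_neq0.
      exact: mulf_neq0.
    by apply: gw; lia.
  apply: rational_prod => s; rewrite mem_index_iota => lt_msj.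
  have [||r1 r2] := IHj s; [lia | lia |].
  apply: rationalB; [exact: rational_const | exact: rationalM].
have [|w1 w2] := @rational_coord R m K good j; first by lia.
split; [apply: (@eq_rational _ _ _ _ (fun w => ((w j).1 - (Pm j).@[coords (sol w)]) *
                 (\prod_(m <= s < j) disc (sol w s))^-1))
      | apply: (@eq_rational _ _ _ _ (fun w => ((w j).2 - (Pp j).@[coords (sol w)]) *
                 (\prod_(m <= s < j) disc (sol w s))^-1))].
- by move=> w _; rewrite [in RHS]recursive_solutionE.
- by apply: rationalM => //; apply: rationalB.
- by move=> w _; rewrite [in RHS]recursive_solutionE.
by apply: rationalM => //; apply: rationalB.
Qed.

(* Nonvanishing is tested at the data w coming from the parameters zeta = 0. *)
Lemma rational_solution_all k : (m <= k)%N -> rational_solution Pm Pp k.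
Proof.
move=> le_mk; have [|[N [D ND]] [N' [D' ND']]] := @rational_recursive_solution k.+1 k.
  by lia.
(* The two components are put over a common denominator. *)
exists (N * D'), (D * N'), (D * D').
pose w0 := recursion_rhs Pm Pp (fun=> 0).
have sol0 s : (m <= s)%N -> sol w0 s = 0.
  move=> le_ms; apply/esym.
  apply: (@recursive_solution_unique _ _ _ _ w0 (fun=> 0) s) => //; last by lia.
  by move=> j _; rewrite /disc mulr0 subr0 oner_neq0.
have disc0 s : (m <= s)%N -> disc (sol w0 s) = 1.
  by move=> le_ms; rewrite sol0 // /disc mulr0 subr0.
have good0 s : (m <= s < k)%N -> disc (sol w0 s) != 0.
  by case/andP=> le_ms _; rewrite disc0 ?oner_neq0.
have [D0 solm0] := ND _ good0; have [D'0 solp0] := ND' _ good0.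
split.
- by apply: contraNneq (mulf_neq0 D0 D'0) => E; rewrite -mevalM E meval0.
(* At [w0] the polynomial D^2 - Nm Np takes the value (D D')^2 times the discriminant of the
   solution, which is 1 there. *)
- have: (D.@[coords w0] * D'.@[coords w0]) ^+ 2 * disc (sol w0 k) != 0.
    by rewrite disc0 // mulr1 expf_neq0 // mulf_neq0.
  apply: contraNneq => /(congr1 (meval (coords w0))).
  rewrite meval0 mevalB expr2 !mevalM => E; rewrite -E /disc solm0 solp0.
  by apply/eqP; field; apply/andP.
move=> w gw; have [Dw solm] := ND _ gw; have [D'w solp] := ND' _ gw.
rewrite !mevalM mulf_neq0 // [LHS]surjective_pairing solm solp; split=> //.
by rewrite -!mulf_div !divff // mulr1 mul1r.
Qed.

End RationalSolution.

(** * Triangular factorizations *)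

Section Triangular.
Variable R : realType.
Local Notation C := R[i].
Implicit Types (g : loop R) (z : circle R) (a b c d p q : {poly C}).

Definition flip_loop g : loop R := fun z => flip (g z).

(** [triangular_polys] is applied to z^N times the lower row; V read backwards gives the
    coefficients of z^-j, conjugated because the factor contains the conjugates of the y_j. The
    number e is the first exponent of the sum. *)
Lemma has_form_lower g a b c d N e : (e <= 1)%N ->
  (forall z, \det (g z) = 1) -> has_form g a b c d -> a`_0 != 0 ->
  (size c <= N.+1)%N -> (size d <= N.+1)%N ->
  exists (y : nat -> C) u v,
    [/\ a * v - b * u = 1, e = 0%N -> u`_0 = 0 &
      forall z, let Y := \sum_(e <= j < N.+1) Num.conj (y j) * (z : C) ^- j in
        c.[(z : C)^-1] = Y * a.[z] + u.[z] /\ d.[(z : C)^-1] = Y * b.[z] + v.[z]].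
Proof.
move=> e1 det1 F a0 sc sd.
have [V [u [v [sV cE dE det u0]]]] := triangular_polys e1 a0 (has_form_det det1 F sc sd).
exists (fun j => Num.conj V`_(N - j)), u, v; split=> // z Y.
have z0 := circle_neq0 z; have zN0 : (z : C) ^+ N != 0 by rewrite expf_neq0.
have YE : V.[z] = (z : C) ^+ N * Y.
  have sV' : (size V <= N.+1)%N := leq_trans sV (leq_subr _ _).
  have -> : Y = (rev_poly N V).[(z : C)^-1].
    rewrite (horner_coef_wide _ (size_rev_poly N V)).
    rewrite -(big_mkord predT (fun j => (rev_poly N V)`_j * (z : C)^-1 ^+ j)).
    rewrite (@big_cat_nat _ _ _ e) //=; last by lia.
    rewrite [X in X + _]big_nat [X in X + _]big1 ?add0r => [|j /= lt_je].
      apply: eq_big_nat => j /andP[_ lt_jN].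
      by rewrite coef_poly lt_jN conjCK exprVn.
    rewrite coef_poly; case: ifP => _; rewrite ?mul0r // nth_default ?mul0r //.
    by apply: leq_trans sV _; lia.
  by rewrite horner_rev_poly ?invr_eq0 // invrK exprVn mulVKf.
split; apply: (mulfI zN0); rewrite -horner_rev_poly //.
  by rewrite cE hornerD hornerM hornerM hornerXn YE; ring.
by rewrite dE hornerD hornerM hornerM hornerXn YE; ring.
Qed.

(** The third factor has rows (a, b) / a1 and a1 (u, v). It is unipotent at 0 because u(0) = 0, and
    then the determinant gives a1 v(0) = 1. *)
Lemma has_form_triangular1 g a b c d N (a1 : C) :
  (forall z, \det (g z) = 1) -> has_form g a b c d -> a`_0 = a1 -> a1 != 0 ->
  (size c <= N.+1)%N -> (size d <= N.+1)%N -> exists y, triangular1 g N y a1.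
Proof.
move=> det1 F aE a1_neq0; have a0 : a`_0 != 0 by rewrite aE.
move=> sc sd; have [y [u [v [det u0 cd]]]] := has_form_lower (leq0n 1) det1 F a0 sc sd.
exists y, (mx22 ((a1^-1)%:P * a) ((a1^-1)%:P * b) (a1%:P * u) (a1%:P * v)).
have evalE (x : C) :
    eval_mx (mx22 ((a1^-1)%:P * a) ((a1^-1)%:P * b) (a1%:P * u) (a1%:P * v)) x =
    mx22 (a1^-1 * a.[x]) (a1^-1 * b.[x]) (a1 * u.[x]) (a1 * v.[x]).
  by rewrite /eval_mx map_mx22 !hornerCM.
have detE (x : C) : a.[x] * v.[x] - b.[x] * u.[x] = 1.
  by rewrite -!hornerM -hornerN -hornerD det hornerC.
split; last first.
  move=> z; rewrite evalE F; have [-> ->] := cd z.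
  by rewrite !mul_mx22; congr mx22; field.
split=> [x|]; first by rewrite evalE det_mx22 -(detE x); field.
exists (a1^-1 * b.[0]); have := detE 0.
rewrite evalE !horner_coef0 u0 // mulr0 subr0 aE => ->.
by rewrite mulr0 mulVf.
Qed.

(** After [flip], a is the lower right entry of g, whence a(0) = 1 / a2. The entry required to
    vanish at 0 is now a2 b, so u(0) is free and e = 1 is the right choice. *)
Lemma has_form_triangular2 g a b c d N (a2 : C) :
  (forall z, \det (g z) = 1) -> has_form (flip_loop g) a b c d ->
  a`_0 = a2^-1 -> a2 != 0 -> b`_0 = 0 ->
  (size c <= N.+1)%N -> (size d <= N.+1)%N -> exists x, triangular2 g N x a2.
Proof.
move=> det1 F aE a2_neq0 b0; have a0 : a`_0 != 0 by rewrite aE invr_eq0.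
have det1' z : \det (flip_loop g z) = 1 by rewrite det_flip.
move=> sc sd; have [y [u [v [det _ cd]]]] := has_form_lower (leqnn 1) det1' F a0 sc sd.
exists y, (mx22 ((a2^-1)%:P * v) ((a2^-1)%:P * u) (a2%:P * b) (a2%:P * a)).
have evalE (x : C) :
    eval_mx (mx22 ((a2^-1)%:P * v) ((a2^-1)%:P * u) (a2%:P * b) (a2%:P * a)) x =
    mx22 (a2^-1 * v.[x]) (a2^-1 * u.[x]) (a2 * b.[x]) (a2 * a.[x]).
  by rewrite /eval_mx map_mx22 !hornerCM.
have detE (x : C) : a.[x] * v.[x] - b.[x] * u.[x] = 1.
  by rewrite -!hornerM -hornerN -hornerD det hornerC.
split; last first.
  move=> z; rewrite evalE -[g z]flipK -[flip (g z)]/(flip_loop g z) F flip_mx22.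
  by have [-> ->] := cd z; rewrite !mul_mx22; congr mx22; field.
split=> [x|]; first by rewrite evalE det_mx22 -(detE x); field.
exists (a2^-1 * u.[0]); have := detE 0.
rewrite evalE !horner_coef0 b0 mul0r subr0 aE => ->.
by rewrite mulr0 mulfV.
Qed.

Lemma inv_star_mx22 g z (a b c d : C) : \det (g z) = 1 -> g z = mx22 a b c d ->
  inv_star g z =
    mx22 (Num.conj d) (- Num.conj c) (- Num.conj b) (Num.conj a).
Proof.
move=> det1 E; rewrite /inv_star E invmx22 -?E //.
by apply: eq_mx22; rewrite !mxE /= ?rmorphN.
Qed.

Lemma det_inv_star g z : \det (g z) = 1 -> \det (inv_star g z) = 1.
Proof.
move=> det1; rewrite (inv_star_mx22 det1 (mx22_eta _)) det_mx22.
move: det1; rewrite [g z]mx22_eta det_mx22 !mxE /= => /(congr1 Num.conj).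
rewrite rmorph1 rmorphB !rmorphM => <-; ring.
Qed.

Lemma inv_star_flip g z : \det (g z) = 1 ->
  inv_star (flip_loop g) z = flip (inv_star g z).
Proof.
move=> det1; rewrite (inv_star_mx22 det1 (mx22_eta _)) flip_mx22.
by apply: inv_star_mx22 => //; rewrite det_flip.
Qed.

Lemma conj_horner_circle p z : Num.conj p.[z] = (map_poly Num.conj p).[(z : C)^-1].
Proof. by rewrite conj_horner circle_conj. Qed.

Lemma conj_horner_circleV p z : Num.conj p.[(z : C)^-1] = (map_poly Num.conj p).[z].
Proof. by rewrite conj_horner -circle_conj conjCK. Qed.

Lemma has_form_inv_star g a b c d :
  (forall z, \det (g z) = 1) -> has_form g a b c d ->
  has_form (inv_star g) (map_poly Num.conj d) (- map_poly Num.conj c)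
    (- map_poly Num.conj b) (map_poly Num.conj a).
Proof.
move=> det1 F z; rewrite (inv_star_mx22 (det1 z) (F z)) !hornerN.
by rewrite !conj_horner_circle !conj_horner_circleV.
Qed.

(** The first row of [inv_star g] is, up to conjugation, order and a sign, the second row of g. *)
Lemma rows_has_form g p q p' q' : (forall z, \det (g z) = 1) ->
  (forall z, g z 0 0 = p.[z] /\ g z 0 1 = q.[z]) ->
  (forall z, inv_star g z 0 0 = p'.[z] /\ inv_star g z 0 1 = q'.[z]) ->
  has_form g p q (- map_poly Num.conj q') (map_poly Num.conj p').
Proof.
move=> det1 row row' z; have [<- <-] := row z; have [] := row' z.
rewrite (inv_star_mx22 (det1 z) (mx22_eta _)) !mxE /= => E1 E2.
rewrite hornerN -!conj_horner_circle -E1 -E2 rmorphN /= opprK !conjCK.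
exact: mx22_eta.
Qed.

(** A lower unipotent factor on the left does not change the first row, which is thus a1 times that
    of the polynomial factor. *)
Lemma triangular1_row g n y (a1 : C) : triangular1 g n y a1 ->
  exists p q, p`_0 = a1 /\ forall z, g z 0 0 = p.[z] /\ g z 0 1 = q.[z].
Proof.
case=> H [[_ [t H0]] gE]; exists (a1%:P * H 0 0), (a1%:P * H 0 1); split=> [|z].
  have /matrixP/(_ 0 0) := H0; rewrite !mxE /= => h0.
  by rewrite coefCM -horner_coef0 h0 mulr1.
rewrite gE [eval_mx H z]mx22_eta !mul_mx22 !mxE /= !hornerCM.
by rewrite !(mul1r, mul0r, mulr0, addr0, add0r).
Qed.

Lemma triangular2_row g n x (a2 : C) : triangular2 g n x a2 ->
  exists p q, [/\ p`_0 = a2^-1, q`_0 = 0 &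
    forall z, flip (g z) 0 0 = p.[z] /\ flip (g z) 0 1 = q.[z]].
Proof.
case=> H [[_ [t H0]] gE].
exists ((a2^-1)%:P * H 1 1), ((a2^-1)%:P * H 1 0); split=> [||z].
- have /matrixP/(_ 1 1) := H0; rewrite !mxE /= => h0.
  by rewrite coefCM -horner_coef0 h0 mulr1.
- have /matrixP/(_ 1 0) := H0; rewrite !mxE /= => h0.
  by rewrite coefCM -horner_coef0 h0 mulr0.
rewrite gE [eval_mx H z]mx22_eta !mul_mx22 !mxE /= !hornerCM.
by rewrite !(mul1r, mul0r, mulr0, addr0, add0r).
Qed.

End Triangular.

(** * Equivalence of the conditions, and the theorem *)

Section Theorem1.
Variable R : realType.
Local Notation C := R[i].
Local Notation conjp := (map_poly (@Num.conj C)).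
Implicit Types (g : loop R) (z : circle R) (a b c d : {poly C}).

Lemma star_inftyE d : star_infty d = (conjp d)`_0.
Proof. by rewrite /star_infty horner_coef0 coef_map. Qed.

Lemma form1P g a b c d : form1 g a b c d <->
  [/\ has_form g a b (conjp c) (conjp d), a`_0 = (conjp d)`_0 & a`_0 != 0].
Proof. by rewrite /form1 star_inftyE horner_coef0. Qed.

Lemma form2P g a b c d : form2 g a b c d <->
  [/\ has_form (flip_loop g) d c (conjp b) (conjp a), c`_0 = 0, b`_0 = 0,
      (conjp a)`_0 = d`_0 & d`_0 != 0].
Proof.
rewrite /form2 star_inftyE !horner_coef0; split=> -[F *]; split=> // z.
  by rewrite /flip_loop F flip_mx22.
by rewrite -[g z]flipK -[flip (g z)]/(flip_loop g z) F flip_mx22.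
Qed.

Lemma fact1P n eta g : fact1 n eta g <-> factorized 0 n eta g.
Proof. by []. Qed.

Lemma fact2P n zeta g : fact2 n zeta g <-> factorized 1 n zeta (flip_loop g).
Proof.
split=> -[nz [s [s2 gE]]]; split=> //; exists s; split=> // z.
  rewrite /flip_loop gE flip_prod; apply: eq_bigr => k _.
  by rewrite flip_scale flip_mx22.
rewrite -[g z]flipK -[flip (g z)]/(flip_loop g z) gE flip_prod; apply: eq_bigr => k _.
by rewrite flip_scale flip_mx22.
Qed.

Lemma size_conj (p : {poly C}) : size (conjp p) = size p.
Proof. exact: size_map_poly. Qed.

Lemma expansion_coef0 (p q : {poly C}) u : expansion p q u -> q`_0 != 0 ->
  p`_0 = 0 -> u 0%N = 0.
Proof.
move=> E q0 p0; have := E 0%N; rewrite big_ord_recl big_ord0 addr0 p0 => /esym/eqP.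
by rewrite mulf_eq0 (negPf q0) orbF => /eqP.
Qed.

Lemma has_form_condI1 g a b c d : has_form g a b c d -> a`_0 = d`_0 -> a`_0 != 0 ->
  condI1 g.
Proof.
move=> F ad a0; exists a, b, (conjp c), (conjp d); apply/form1P.
by rewrite !map_poly_conjK.
Qed.

Lemma has_form_condII1 g a b c d : has_form (flip_loop g) a b c d ->
  b`_0 = 0 -> c`_0 = 0 -> a`_0 = d`_0 -> a`_0 != 0 -> condII1 g.
Proof.
move=> F b0 c0 ad a0; exists (conjp d), (conjp c), b, a; apply/form2P.
by rewrite !map_poly_conjK coef_map /= c0 rmorph0 -ad.
Qed.

(** The diagonal constants of g and [inv_star g] are a(0) and d(0), so the normalization in (I.1)
    says that they are conjugate. Conversely, the first rows of the two factorizations determine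
    g. *)
Lemma condI1_condI3 g : (forall z, \det (g z) = 1) -> condI1 g <-> condI3 g.
Proof.
move=> det1; split=> [[a [b [c [d /form1P[F ad a0]]]]] | ].
  have F' := has_form_inv_star det1 F.
  have det1' z := det_inv_star (det1 z).
  pose N := maxn (maxn (size a) (size b)) (maxn (size c) (size d)).
  have sz (p : {poly C}) : (size p <= N)%N -> (size (conjp p) <= N.+1)%N.
    by rewrite size_conj => /leqW.
  have [||y tri] := has_form_triangular1 (N := N) det1 F erefl a0.
  - by apply: sz; rewrite /N; lia.
  - by apply: sz; rewrite /N; lia.
  have [||||y' tri'] := has_form_triangular1 (N := N) (a1 := Num.conj a`_0) det1' F'.
  - by rewrite map_poly_conjK ad coef_map /= conjCK.
  - by rewrite fmorph_eq0.
  - by rewrite size_polyN sz // /N; lia.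
  - by rewrite sz // /N; lia.
  by exists a`_0; split=> //; exists N, y, y'.
case=> a1 [a1_neq0 [n [y [y' [tri tri']]]]].
have [p [q [p0 row]]] := triangular1_row tri.
have [p' [q' [p'0 row']]] := triangular1_row tri'.
exists p, q, (- q'), p'; apply/form1P; split.
- by rewrite rmorphN; exact: rows_has_form det1 row row'.
- by rewrite coef_map /= p'0 conjCK.
by rewrite p0.
Qed.

Lemma condII1_condII3 g : (forall z, \det (g z) = 1) -> condII1 g <-> condII3 g.
Proof.
move=> det1; have det1f z : \det (flip_loop g z) = 1 by rewrite det_flip.
have det1' z := det_inv_star (det1 z).
split=> [[a [b [c [d /form2P[F c0 b0 ad d0]]]]] | ].
  have F' : has_form (flip_loop (inv_star g))
      (conjp (conjp a)) (- conjp (conjp b)) (- conjp c) (conjp d).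
    by move=> z; rewrite /flip_loop -inv_star_flip //; exact: has_form_inv_star.
  rewrite !map_poly_conjK in F'.
  pose N := maxn (maxn (size a) (size b)) (maxn (size c) (size d)).
  have sz (p : {poly C}) : (size p <= N)%N -> (size (conjp p) <= N.+1)%N.
    by rewrite size_conj => /leqW.
  (* The lower right entry has constant term 1 / a2, which forces a2 = 1 / d(0). *)
  have [|||||x tri] := has_form_triangular2 (N := N) (a2 := (d`_0)^-1) det1 F.
  - by rewrite invrK.
  - by rewrite invr_eq0.
  - by [].
  - by rewrite sz // /N; lia.
  - by rewrite sz // /N; lia.
  have [|||||x' tri'] :=
    has_form_triangular2 (N := N) (a2 := Num.conj (d`_0)^-1) det1' F'.
  - by rewrite fmorphV invrK -ad coef_map /= conjCK.
  - by rewrite fmorph_eq0 invr_eq0.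
  - by rewrite coefN b0 oppr0.
  - by rewrite size_polyN sz // /N; lia.
  - by rewrite sz // /N; lia.
  by exists (d`_0)^-1; split; [rewrite invr_eq0 | exists N, x, x'].
case=> a2 [a2_neq0 [n [x [x' [tri tri']]]]].
have [p [q [p0 q0 row]]] := triangular2_row tri.
have [p' [q' [p'0 q'0 row']]] := triangular2_row tri'.
exists p', (- q'), q, p; apply/form2P; split=> //.
- rewrite rmorphN; apply: rows_has_form det1f row _ => z.
  by rewrite inv_star_flip.
- by rewrite coefN q'0 oppr0.
- by rewrite coef_map /= p'0 fmorphV /= conjCK p0.
by rewrite p0 invr_eq0.
Qed.

Lemma condI2_condI1 g : condI2 g -> condI1 g.
Proof.
case=> n [eta /fact1P/factorized_has_form[s s0]]; set e := from_index 0 eta => F.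
by apply: (has_form_condI1 F); rewrite !scale_denom_coef0.
Qed.

(** Both diagonal polynomials have constant term s, the product of the square roots; the
    off-diagonal ones vanish at 0 because the padded parameter of index 0 is 0. *)
Lemma condII2_condII1 g : condII2 g -> condII1 g.
Proof.
case=> n [zeta /fact2P/factorized_has_form[s s0]]; set e := from_index 1 zeta => F.
by apply: (has_form_condII1 F); rewrite ?scale_denom_coef0 ?scale_numer_coef0.
Qed.

End Theorem1.

Theorem theorem1 (R : realType) :
  (* Part I *)
  ((forall g : loop R, LfinSL2 g ->
      (condI1 g <-> condI3 g) /\ (condI2 g -> condI1 g /\ condI3 g)) /\
   exists Pm Pp : poly_family R 0,
     [/\ forall (g : loop R) (a b c d : {poly R[i]}) (w : nat -> R[i] * R[i])
                (n : nat) (eta : nat -> R[i] * R[i]),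
           LfinSL2 g -> form1 g a b c d -> laurent_data b a c d w ->
           fact1 n eta g ->
           forall k, (k <= n)%N ->
             w k = recursion_rhs Pm Pp eta k /\
             eta k = recursive_solution Pm Pp w k,
         forall k, rational_solution Pm Pp k &
         forall (g : loop R) (a b c d : {poly R[i]}) (w : nat -> R[i] * R[i])
                (n : nat),
           LfinSL2 g -> form1 g a b c d -> laurent_data b a c d w ->
           sizes_le n.+1 a b c d ->
           (forall k, (k <= n)%N -> disc (recursive_solution Pm Pp w k) != 0) ->
           fact1 n (recursive_solution Pm Pp w) g]) /\
  (* Part II *)
  ((forall g : loop R, LfinSL2 g ->
      (condII1 g <-> condII3 g) /\ (condII2 g -> condII1 g /\ condII3 g)) /\
   exists Pm Pp : poly_family R 1,
     [/\ forall (g : loop R) (a b c d : {poly R[i]}) (w : nat -> R[i] * R[i])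
                (n : nat) (zeta : nat -> R[i] * R[i]),
           LfinSL2 g -> form2 g a b c d -> laurent_data c d b a w ->
           fact2 n zeta g ->
           forall k, (1 <= k <= n)%N ->
             w k = recursion_rhs Pm Pp zeta k /\
             zeta k = recursive_solution Pm Pp w k,
         forall k, (1 <= k)%N -> rational_solution Pm Pp k &
         forall (g : loop R) (a b c d : {poly R[i]}) (w : nat -> R[i] * R[i])
                (n : nat),
           LfinSL2 g -> form2 g a b c d -> laurent_data c d b a w ->
           (1 <= n)%N -> sizes_le n.+1 a b c d ->
           (forall k, (1 <= k <= n)%N ->
              disc (recursive_solution Pm Pp w k) != 0) ->
           fact2 n (recursive_solution Pm Pp w) g]).
Proof.
split; split.
- move=> g [det1 _]; split; first exact: condI1_condI3.
  by move=> /condI2_condI1 g1; split=> //; apply/condI1_condI3.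
- exists (@minus_poly R 0), (@plus_poly R 0); split.
  + move=> g a b c d w n eta _ /form1P[F _ _] [wp wm] /fact1P fac k le_kn.
    have rec := factorized_recursion fac F wp wm.
    split; first exact: rec.
    by apply: recursive_solution_unique rec k le_kn; case: fac.
  + by move=> k; apply: rational_solution_all.
  move=> g a b c d w n [det1 _] /form1P[F ad a0] [wp wm] [sa sb sc sd] nz.
  apply/fact1P/(factorized_recursive_solution _ det1 F ad a0 wp wm) => //.
  by split; rewrite ?size_conj.
- move=> g [det1 _]; split; first exact: condII1_condII3.
  by move=> /condII2_condII1 g2; split=> //; apply/condII1_condII3.
exists (@minus_poly R 1), (@plus_poly R 1); split.
- move=> g a b c d w n zeta _ /form2P[F _ _ _ _] [wp wm] /fact2P fac k le_kn.
  have rec := factorized_recursion fac F wp wm.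
  split; first exact: rec.
  by apply: recursive_solution_unique rec k le_kn; case: fac.
- exact: rational_solution_all.
move=> g a b c d w n [det1 _] /form2P[F c0 b0 ad d0] [wp wm] n1 [sa sb sc sd] nz.
have det1f z : \det (flip_loop g z) = 1 by rewrite det_flip.
apply/fact2P/(factorized_recursive_solution n1 det1f F (esym ad) d0 wp wm) => //.
  (* The products start at 1, so the data of index 0 must vanish; they do since c(0) = b(0) = 0. *)
  case=> // _; rewrite [w 0%N]surjective_pairing (expansion_coef0 wp d0 c0).
  by rewrite (expansion_coef0 wm) ?ad // coef_map b0 raddf0.
by split; rewrite ?size_conj.
Qed.
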